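(* Let $n=2$ or $n=3$, let $p>1$, and let $F\in C^1(\mathbb{R})$ satisfy $F(s)\ge A s^p$ for all $s\ge 0$, for some constant $A>0$. Let $0<\kappa<\kappa_0:=\frac{2}{p-1}$. Let $f\in C^3(\mathbb{R}^n)$ and $g\in C^2(\mathbb{R}^n)$, and suppose there exist constants $R>0$ and $C_0>0$ such that for all $|x|\ge R$, $$f(x)>0 \quad\text{and}\quad \frac{f(x)}{1+|x|}-|\nabla f(x)|+g(x)\ge \frac{C_0}{(1+|x|)^{1+\kappa}}.$$ Let $u$ be a solution of the Cauchy problem $$u_{tt}-\Delta u=F(u)\ \text{ in } \mathbb{R}^n\times[0,\infty),\qquad u(x,0)=f(x),\ u_t(x,0)=g(x)\ \text{ in }\mathbb{R}^n.$$ Then $u$ cannot exist globally in time.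
   Context: Here $\Delta$ is the Laplacian in $x\in\mathbb{R}^n$ and $u=u(x,t)$ is a scalar (classical) solution; ''cannot exist globally in time'' means there is no solution defined for all $t\in[0,\infty)$. No radial symmetry is assumed. *)

(* Defs.v *)
From HB Require Import structures.
From mathcomp Require Import all_boot all_order all_algebra.
From mathcomp Require Import all_classical all_reals all_analysis.
Set Implicit Arguments. Unset Strict Implicit. Unset Printing Implicit Defensive.
Import Order.TTheory GRing.Theory Num.Theory.
Import numFieldNormedType.Exports.
Local Open Scope classical_set_scope.
Local Open Scope ring_scope.

Section Defs.
Variables (R : realType) (n : nat).

Definition evec (i : 'I_n) : 'rV[R]_n := delta_mx 0 i.

(* Euclidean norm |x| (mathcomp's norm on 'rV is the sup norm, so we define it) *)
Definition enorm (x : 'rV[R]_n) : R := Num.sqrt (\sum_(i < n) (x 0 i) ^+ 2).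

Fixpoint Ck (k : nat) (f : 'rV[R]_n -> R) : Prop :=
  match k with
  | 0 => continuous f
  | k.+1 => continuous f /\
      forall i : 'I_n, (forall x, derivable f x (evec i)) /\
                       Ck k (fun x => 'D_(evec i) f x)
  end.

Definition gradnorm (f : 'rV[R]_n -> R) (x : 'rV[R]_n) : R :=
  Num.sqrt (\sum_(i < n) ('D_(evec i) f x) ^+ 2).

(* Functions of (x,t); only the values for t >= 0 matter.
   Direction None = time, Some i = x_i.
   [pd k v w] : w is the partial derivative of v in direction k at every point
   of the closed half-space t >= 0 (one-sided in time at t = 0). *)
Definition pd (k : option 'I_n) (v w : 'rV[R]_n -> R -> R) : Prop :=
  forall (x : 'rV[R]_n) (t : R), 0 <= t ->
  match k with
  | None => (fun h : R => h^-1 * (v x (t + h) - v x t))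
              @ within (fun h : R => 0 <= t + h) (0 : R)^' --> w x t
  | Some i => (fun h : R => h^-1 * (v (x + h *: evec i) t - v x t))
              @ (0 : R)^' --> w x t
  end.

Definition cont_half (v : 'rV[R]_n -> R -> R) : Prop :=
  {within [set p : 'rV[R]_n * R | 0 <= p.2], continuous (fun p => v p.1 p.2)}.

Definition global_classical_solution (F : R -> R) (f g : 'rV[R]_n -> R)
  (u : 'rV[R]_n -> R -> R) : Prop :=
  exists (D1 : option 'I_n -> 'rV[R]_n -> R -> R)
         (D2 : option 'I_n -> option 'I_n -> 'rV[R]_n -> R -> R),
    cont_half u /\
    (forall k, pd k u (D1 k) /\ cont_half (D1 k)) /\
    (forall k l, pd l (D1 k) (D2 k l) /\ cont_half (D2 k l)) /\
    (forall x t, 0 <= t ->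
       D2 None None x t - \sum_(i < n) D2 (Some i) (Some i) x t = F (u x t)) /\
    (forall x, u x 0 = f x) /\
    (forall x, D1 None x 0 = g x).

End Defs.

(* Main.v *)
Require Import Defs.
From HB Require Import structures.
From mathcomp Require Import all_boot all_order all_algebra.
From mathcomp Require Import all_classical all_reals all_analysis.
From mathcomp Require Import ring lra.
Import Order.TTheory GRing.Theory Num.Theory.
Import numFieldNormedType.Exports.
Local Open Scope classical_set_scope.
Local Open Scope ring_scope.

(** Let u be a global solution. Along the backward characteristic cone of
    (x0, t0), put U(r, th, ph) = u(x0 + r om, t0 - r) with om = om(th, ph) on the
    unit sphere of R^3 (projected to R^2 when n = 2). The flux
    sin th * (u + r (om.grad u + u_t)), completed by two angular fields, has
    divergence - r sin th F(u); the polar field vanishes at the poles and the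
    azimuthal one is periodic. Averaging over a fine grid of angles (uniform
    continuity makes the Riemann sums of the angular derivatives small) gives
    Kirchhoff's lower bound: if F(u) >= 0 on the cone and F(u) >= B after time
    s0, then u(x0, t0) >= l + B (t0 - s0)^2 / 2, where l bounds
    f - t0 |grad f| + t0 g from below on the base.

    Take |x0| = 4T with T large. On the backward cone of (x0, T) the hypothesis
    on the data gives l >= c t T^(-1-kappa), so u > 0 there by looking at a first
    zero, and u >= e = c T^(-kappa) for t >= T/2. If u >= 2^j e from
    some time on, the bound with B = A (2^j e)^p gives u >= 2^(j+1) e after a
    further time proportional to e^(-(p-1)/2) 2^(-j(p-1)/2). These times sum to
    O(T^(kappa (p-1)/2)) = o(T), so u(x0, T) >= 2^j e for every j. *)

(** * Real calculus *)

(** Distances to [a] replace intervals so that [b] may lie on either side of [a]; the increments met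
    below have no known sign. *)
Lemma mean_value {R : realType} (f df : R -> R) (a b : R) :
  (forall x, `|x - a| <= `|b - a| -> is_derive x 1 f (df x)) ->
  exists2 c, `|c - a| <= `|b - a| & f b - f a = df c * (b - a).
Proof.
move=> fd; have [ab|ba|<-] := ltgtP a b; last first.
- by exists a => //; rewrite !subrr mulr0.
- have sub x : x \in `[b, a] -> `|x - a| <= `|b - a|.
    by rewrite in_itv/= => /andP[bx xa]; rewrite !ler0_norm; lra.
  have [||c] := @MVT _ f df b a ba.
  + by move=> x /subset_itv_oo_cc/sub/fd.
  + by apply: derivable_within_continuous => x /sub /fd[].
  + by move=> /subset_itv_oo_cc/sub cb E; exists c => //; lra.
- have sub x : x \in `[a, b] -> `|x - a| <= `|b - a|.
    by rewrite in_itv/= => /andP[ax xb]; rewrite !ger0_norm; lra.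
  have [||c] := @MVT _ f df a b ab.
  + by move=> x /subset_itv_oo_cc/sub/fd.
  + by apply: derivable_within_continuous => x /sub /fd[].
  + by move=> /subset_itv_oo_cc/sub cb E; exists c.
Qed.

(** The increment splits into one in the second argument alone, whose derivative is [d], and one in
    the first argument, controlled by the mean value theorem. Continuity is required of the first
    partial derivative only, which suits the coordinate-by-coordinate induction of [chain_rule]. *)
Lemma is_derive_two_args {R : realType} (G dG : R -> R -> R) (a : R -> R)
    (s0 a' d : R) :
  (\forall p \near (a s0, s0), is_derive (p.1 : R) (1 : R) (G^~ p.2) (dG p.1 p.2)) ->
  {for (a s0, s0), continuous (fun p : R * R => dG p.1 p.2)} ->
  is_derive s0 1 a a' -> is_derive s0 1 (G (a s0)) d ->
  is_derive s0 1 (fun s => G (a s) s) (d + dG (a s0) s0 * a').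
Proof.
move=> Gd cG da dd.
rewrite (_ : (fun s => _) = G (a s0) + (fun s => G (a s) s - G (a s0) s)); last first.
  by apply/funext => s /=; rewrite !fctE; lra.
apply: is_deriveD.
have ca : {for s0, continuous a}.
  by apply/differentiable_continuous; rewrite -derivable1_diffP; case: da.
have /is_derive1_caratheodory[g [ag cg ga]] := da.
(* The slope of [G^~ s] between [a s0] and [a s]. The value [dG (a s0) s0] fills in where the two
   points coincide, and the mean value theorem makes [m] continuous at [s0]; [m * g] is then a
   Caratheodory slope. *)
pose m s := if a s == a s0 then dG (a s0) s0 else (G (a s) s - G (a s0) s) / (a s - a s0).
apply/is_derive1_caratheodory; exists (fun s => m s * g s); split.
- move=> s; rewrite subrr subr0 -mulrA -ag /m.
  case: eqP => [->|/eqP n]; first by rewrite !subrr mulr0.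
  by rewrite divfK// subr_eq0.
- suff cm : {for s0, continuous m} by exact: continuousM.
  apply/cvgrPdist_lt => e e0 /=.
  have ms0 : m s0 = dG (a s0) s0 by rewrite /m eqxx.
  rewrite ms0.
  move: cG => /cvgrPdist_lt /(_ e e0)/= cG.
  have [del/= del0 H] : exists2 del : R, 0 < del & forall x s, `|x - a s0| < del -> `|s - s0| < del ->
     is_derive x 1 (G^~ s) (dG x s) /\ `|dG (a s0) s0 - dG x s| < e.
    have [del/= del0 H] := (nbhs_ballP (a s0, s0) _).1 (filterI Gd cG).
    exists del => // x s xa ss.
    by apply: (H (x, s)); split; rewrite /ball/= distrC.
  move: ca => /cvgrPdist_lt/(_ _ del0) nca.
  near=> s.
  have : `|s0 - s| < del by near: s; exact: (nbhsx_ballx s0 del del0).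
  have : `|a s0 - a s| < del by near: s; exact: nca.
  rewrite /ball/= => s2 s1; rewrite /m.
  case: eqP => [_|/eqP n]; first by rewrite subrr normr0.
  have [x xs|c cs ->] := @mean_value _ (G^~ s) (fun x => dG x s) (a s0) (a s).
    by apply: (H x s _ _).1; [rewrite (le_lt_trans xs)// distrC|rewrite distrC].
  rewrite mulfK ?subr_eq0//.
  by apply: (H c s _ _).2; [rewrite (le_lt_trans cs)// distrC|rewrite distrC].
- by rewrite /m eqxx ga.
Unshelve. all: by end_near. Qed.

(** The second difference of [U] over a small square of side [h] is, by the mean value theorem
    applied twice in either order, [h ^+ 2] times a value of [Uab] and also [h ^+ 2] times a value
    of [Uba]. Continuity at the corner brings both values to [(a0, b0)]. *)
Lemma mixed_partials {R : realType} (U Ua Ub Uab Uba : R -> R -> R) (a0 b0 e : R) :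
  0 < e ->
  (forall a b, `|a - a0| < e -> `|b - b0| < e ->
    [/\ is_derive a 1 (U^~ b) (Ua a b), is_derive b 1 (U a) (Ub a b),
        is_derive b 1 (Ua a) (Uab a b) & is_derive a 1 (Ub^~ b) (Uba a b)]) ->
  {for (a0, b0), continuous (fun p : R * R => Uab p.1 p.2)} ->
  {for (a0, b0), continuous (fun p : R * R => Uba p.1 p.2)} ->
  Uab a0 b0 = Uba a0 b0.
Proof.
move=> e0 Ud cab cba; apply/eqP; rewrite -subr_eq0 -normr_eq0 eq_le normr_ge0 andbT.
apply/ler_addgt0Pr => k k0; rewrite add0r.
have k20 : 0 < k / 2 by rewrite divr_gt0.
move: cab => /cvgrPdist_lt/(_ _ k20) cab; move: cba => /cvgrPdist_lt/(_ _ k20) cba.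
have [del/= del0 H] := (nbhs_ballP (a0, b0) _).1 (filterI cab cba).
pose h := Num.min e del / 2.
have m0 : 0 < Num.min e del by rewrite lt_min e0 del0.
have he : h < e.
  have : Num.min e del <= e by rewrite ge_min lexx.
  by rewrite /h; lra.
have hd : h < del.
  have : Num.min e del <= del by rewrite ge_min lexx orbT.
  by rewrite /h; lra.
have h0 : 0 < h by rewrite divr_gt0.
have ah : `|a0 + h - a0| = h by rewrite addrC addKr gtr0_norm.
have bh : `|b0 + h - b0| = h by rewrite addrC addKr gtr0_norm.
have [x|c1 c1h E1] := @mean_value _ (fun a => U a (b0 + h) - U a b0)
    (fun a => Ua a (b0 + h) - Ua a b0) a0 (a0 + h).
  rewrite ah => xa; have xe := le_lt_trans xa he.
  apply: is_deriveB; first by have [] := Ud x (b0 + h) xe; rewrite ?bh.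
  by have [] := Ud x b0 xe; rewrite ?subrr ?normr0.
have [y|d1 d1h E2] := @mean_value _ (Ua c1) (Uab c1) b0 (b0 + h).
  rewrite bh => ya; have ye := le_lt_trans ya he.
  by have [] := Ud c1 y _ ye; rewrite ?(le_lt_trans _ he)// -[leRHS]ah.
have [y|d2 d2h E3] := @mean_value _ (fun b => U (a0 + h) b - U a0 b)
    (fun b => Ub (a0 + h) b - Ub a0 b) b0 (b0 + h).
  rewrite bh => ya; have ye := le_lt_trans ya he.
  apply: is_deriveB; first by have [] := Ud (a0 + h) y _ ye; rewrite ?ah.
  by have [] := Ud a0 y _ ye; rewrite ?subrr ?normr0.
have [x|c2 c2h E4] := @mean_value _ (Ub^~ d2) (Uba^~ d2) a0 (a0 + h).
  rewrite ah => xa; have xe := le_lt_trans xa he.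
  by have [] := Ud x d2 xe; rewrite ?(le_lt_trans _ he)// -[leRHS]bh.
rewrite ah in c1h c2h; rewrite bh in d1h d2h.
have E : Uab c1 d1 = Uba c2 d2.
  have hn : h != 0 by rewrite gt_eqF.
  apply: (mulIf hn); apply: (mulIf hn).
  have eh z : z + h - z = h by ring.
  move: E1 E2 E3 E4; rewrite !eh => /= E1 E2 E3 E4.
  by rewrite -E2 -E4 -E1 -E3; ring.
have [K1 _] : `|Uab a0 b0 - Uab c1 d1| < k / 2 /\ `|Uba a0 b0 - Uba c1 d1| < k / 2.
  by apply: (H (c1, d1)); split; rewrite /ball/= distrC (le_lt_trans _ hd).
have [_ K2] : `|Uab a0 b0 - Uab c2 d2| < k / 2 /\ `|Uba a0 b0 - Uba c2 d2| < k / 2.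
  by apply: (H (c2, d2)); split; rewrite /ball/= distrC (le_lt_trans _ hd).
rewrite (_ : Uab a0 b0 - _ = (Uab a0 b0 - Uab c1 d1) - (Uba a0 b0 - Uba c2 d2)); last first.
  by rewrite E; ring.
by rewrite (le_trans (ler_normB _ _))// [leRHS]splitr lerD// ltW.
Qed.

(** Only [x] must lie in [K], so when two grid points are compared membership is checked for one of
    them. The proof covers [K] by neighbourhoods on which one small radius works. *)
Lemma compact_uniform_continuity {R : realType} {T : pseudoMetricType R}
    (K : set T) (G : T -> R) (e : R) :
  compact K -> continuous G -> 0 < e ->
  exists2 d : R, 0 < d & forall x y, K x -> ball x d y -> `|G x - G y| < e.
Proof.
move=> cK cG e0.
have /compact_near_coveringP := cK.
move=> /(_ R (0%R : R)^'+ (fun d x => forall y, ball x d y -> `|G x - G y| < e) _).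
case.
  move=> x Kx.
  have e20 : 0 < e / 2 by rewrite divr_gt0.
  have /cvgrPdist_lt/(_ _ e20)/nbhs_ballP[d/= d0 H] := cG x.
  exists (ball x (d / 2), [set z : R | z < d / 2]).
    split; first by apply: nbhsx_ballx; rewrite divr_gt0.
    by apply: nbhs_right_lt; rewrite divr_gt0.
  move=> [x' z]/= [xx' zd] y x'y.
  have H1 : `|G x - G x'| < e / 2.
    by apply: H; apply: le_ball xx'; rewrite ler_pdivrMr// ler_peMr ?ltW// ltr1n.
  have H2 : `|G x - G y| < e / 2.
    apply: H; rewrite (splitr d); apply: ball_triangle xx' _.
    by apply: le_ball x'y; exact: ltW.
  rewrite (_ : _ - _ = (G x - G y) - (G x - G x')); last by ring.
  by rewrite (le_lt_trans (ler_normB _ _))// [ltRHS]splitr ltrD.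
move=> d/= d0 H; exists (d / 2); first by rewrite divr_gt0.
move=> x y Kx; apply: H => //=; last by rewrite divr_gt0.
by rewrite sub0r normrN gtr0_norm ?divr_gt0// ltr_pdivrMr// ltr_pMr// ltr1n.
Qed.

(** The increment [q b - q a] telescopes over the cells, and on each cell it equals [dq c] times the
    step for some [c] of that cell. Replacing [c] by the left endpoint costs at most [e] times the
    step. *)
Lemma riemann_sum_error {R : realType} (q dq : R -> R) (a b e : R) (N : nat) :
  a <= b ->
  (forall x, a <= x <= b -> is_derive x 1 q (dq x)) ->
  (forall x y, a <= x <= b -> a <= y <= b -> `|y - x| <= (b - a) / N.+1%:R ->
     `|dq x - dq y| <= e) ->
  `|(\sum_(k < N.+1) dq (a + k%:R * ((b - a) / N.+1%:R))) * ((b - a) / N.+1%:R)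
    - (q b - q a)| <= e * (b - a).
Proof.
move=> ab qd osc; set h := (b - a) / N.+1%:R.
have h0 : 0 <= h by rewrite divr_ge0 ?subr_ge0.
have hN : h * N.+1%:R = b - a by rewrite divfK// pnatr_eq0.
have tel : q b - q a = \sum_(k < N.+1) (q (a + k.+1%:R * h) - q (a + k%:R * h)).
  have := telescope_sumr (fun k : nat => q (a + k%:R * h)) (leq0n N.+1).
  rewrite big_mkord => ->.
  by rewrite mul0r addr0 mulrC hN addrCA subrr addr0.
rewrite tel mulr_suml -sumrB (le_trans (ler_norm_sum _ _ _))//.
have -> : e * (b - a) = \sum_(k < N.+1) e * h.
  by rewrite sumr_const card_ord -hN -mulr_natr; ring.
apply: ler_sum => k _.
have kN : a + k.+1%:R * h <= b.
  by rewrite -lerBrDl -hN mulrC ler_wpM2l// ler_nat ltn_ord.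
have ka : a <= a + k%:R * h by rewrite lerDl mulr_ge0.
have hk : a + k.+1%:R * h - (a + k%:R * h) = h by rewrite -natr1; ring.
have rng x : `|x - (a + k%:R * h)| <= h -> a + k%:R * h <= x -> a <= x <= b.
  move=> + x1; rewrite ger0_norm ?subr_ge0// => x2.
  by rewrite (le_trans ka x1) (le_trans _ kN)//; move: x2 hk; lra.
have [c /andP[c1 c2] ->] : exists2 c, a + k%:R * h <= c <= a + k.+1%:R * h &
    q (a + k.+1%:R * h) - q (a + k%:R * h) = dq c * h.
  have le1 : a + k%:R * h <= a + k.+1%:R * h by rewrite -subr_ge0 hk.
  have [||c] := @MVT_segment _ q dq _ _ le1.
  - move=> x /subset_itv_oo_cc; rewrite in_itv/= => /andP[x1 x2]; apply: qd.
    by rewrite (le_trans ka)// (le_trans x2).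
  - apply: derivable_within_continuous => x; rewrite in_itv/= => /andP[x1 x2].
    have /qd[]// : a <= x <= b by rewrite (le_trans ka)// (le_trans x2).
  - by rewrite in_itv/= hk => cb ->; exists c.
rewrite -mulrBl normrM (ger0_norm h0) ler_wpM2r//.
have cc : c - (a + k%:R * h) <= h by move: c2 hk; lra.
apply: osc.
- by rewrite ka/= (le_trans _ kN)//; move: hk; lra.
- by rewrite (le_trans ka c1) (le_trans c2).
- by rewrite ger0_norm ?subr_ge0.
Qed.

(** * Functions of space and time *)

Lemma is_derive_difference_quotient {R : realType} (f : R -> R) (x d : R) :
  (fun h => h^-1 * (f (x + h) - f x)) @ (0 : R)^' --> d -> is_derive x 1 f d.
Proof.
move=> H.
have H' : (fun h : R => h^-1 *: (f (h *: (1 : R) + x) - f x)) @ (0 : R)^' --> d.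
  rewrite (_ : (fun h : R => _) = (fun h => h^-1 * (f (x + h) - f x)))//.
  by apply: funext => h; rewrite /GRing.scale/= mulr1 (addrC h).
by split; [apply/cvg_ex; exists d|exact: cvg_lim].
Qed.

Lemma continuous_pair {T U V : topologicalType} (f : T -> U) (g : T -> V) (x : T) :
  {for x, continuous f} -> {for x, continuous g} ->
  {for x, continuous (fun y => (f y, g y))}.
Proof. by move=> cf cg; exact: cvg_pair cf cg. Qed.

Section Partials.
Context {R : realType} {n : nat}.
Implicit Types (v : 'rV[R]_n -> R -> R) (w : option 'I_n -> 'rV[R]_n -> R -> R).

(* Freezing a function of (x, t) at time 0 for t < 0 makes it continuous on the
   whole space without changing it on the half-space. *)
Definition clamp v : 'rV[R]_n -> R -> R := fun x t => v x (Num.max t 0).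

Lemma clampE v x t : 0 <= t -> clamp v x t = v x t.
Proof. by move=> t0; rewrite /clamp max_l. Qed.

Lemma continuous_clamp v :
  cont_half v -> continuous (fun p : 'rV[R]_n * R => clamp v p.1 p.2).
Proof.
move=> /subspace_continuousP cv p.
have mp0 : [set q : 'rV[R]_n * R | 0 <= q.2] (p.1, Num.max p.2 0).
  by rewrite /= le_max lexx orbT.
apply: (@cvg_comp _ _ _ (fun p : 'rV[R]_n * R => (p.1, Num.max p.2 0)) (fun q => v q.1 q.2)
   _ _ _ _ (cv _ mp0)).
have cm : {for p, continuous (fun p : 'rV[R]_n * R => (p.1, Num.max p.2 0))}.
  apply: continuous_pair; first exact: cvg_fst.
  by apply: (@continuous_max _ _ snd (cst 0)); [exact: cvg_snd|exact: cvg_cst].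
move=> A; rewrite /within/= => wA.
have := cm _ wA; rewrite /nbhs/=; apply: filterS => q; apply => /=.
by rewrite le_max lexx orbT.
Qed.

(** The two-sided form of [pd] that survives clamping: derivatives are asked only at times [t > 0],
    along whole coordinate lines, while the [w k] are continuous on all of space-time. *)
Definition has_partials v w :=
  [/\ forall k, continuous (fun p : 'rV[R]_n * R => w k p.1 p.2),
      forall i x (t a : R), 0 < t -> is_derive a 1 (fun a : R => v (x + a *: evec R i) t)
                                   (w (Some i) (x + a *: evec R i) t) &
      forall x (t : R), 0 < t -> is_derive t 1 (v x) (w None x t)].

Lemma has_partials_clamp v w :
  (forall k, pd k v (w k) /\ cont_half (w k)) ->
  has_partials (clamp v) (fun k => clamp (w k)).
Proof.
move=> H; split.
- by move=> k; apply: continuous_clamp; exact: (H k).2.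
- move=> i x t a t0; apply: is_derive_difference_quotient.
  have /(_ (x + a *: evec R i) t (ltW t0)) := (H (Some i)).1.
  rewrite !clampE ?ltW//.
  rewrite (_ : (fun h => _) = (fun h => h^-1 * (clamp v (x + (a + h) *: evec R i) t -
    v (x + a *: evec R i) t)))//.
  by apply/funext => h; rewrite clampE ?ltW// scalerDl addrA.
- move=> x t t0; apply: is_derive_difference_quotient.
  have cw := (H None).1 x t (ltW t0).
  rewrite !clampE ?ltW// => A nA.
  (* Since [t > 0], small increments stay in the half-space and the one-sided limit becomes
     two-sided. *)
  have nt : \forall h \near (0 : R)^', 0 <= t + h.
    exists t => // h; rewrite /= sub0r normrN ltr_norml => /andP[th _] _.
    by lra.
  have := cw A nA; rewrite /within/= /nbhs/= => nAt.
  apply: filterS2 nt nAt => h h0 /(_ h0).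
  by rewrite /= clampE.
Qed.

(** Only partial derivatives are given, so the coordinates are set in motion one at a time: [Y l]
    moves those listed in [l] and keeps the others at their value at [s0]. Each new coordinate is
    one use of [is_derive_two_args]. *)
Lemma chain_rule v w (X : R -> 'rV[R]_n) (T : R -> R) (s0 T' : R) (X' : 'I_n -> R) :
  has_partials v w -> 0 < T s0 ->
  (forall i, is_derive s0 1 (fun s => X s 0 i) (X' i)) -> is_derive s0 1 T T' ->
  is_derive s0 1 (fun s => v (X s) (T s))
    (w None (X s0) (T s0) * T' + \sum_i w (Some i) (X s0) (T s0) * X' i).
Proof.
move=> [cw dx dt] T0 dX dT.
pose Y (l : seq 'I_n) s : 'rV[R]_n :=
  X s0 + \sum_(i <- l) (X s 0 i - X s0 0 i) *: evec R i.
have Ys0 l : Y l s0 = X s0.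
  by rewrite /Y big1 ?addr0// => i _; rewrite subrr scale0r.
have cT : {for s0, continuous T}.
  by apply/differentiable_continuous; rewrite -derivable1_diffP; case: dT.
have cX i : {for s0, continuous (fun s => X s 0 i)}.
  by apply/differentiable_continuous; rewrite -derivable1_diffP; case: (dX i).
have cY l : {for s0, continuous (Y l)}.
  elim: l => [|i l IH].
    rewrite /Y (_ : (fun s => _) = cst (X s0)); first exact: cvg_cst.
    by apply/funext => s; rewrite big_nil addr0.
  rewrite (_ : Y _ = fun s => (X s 0 i - X s0 0 i) *: evec R i + Y l s); last first.
    by apply/funext => s; rewrite /Y big_cons addrCA.
  apply: continuousD; last exact: IH.
  apply: continuousZr_tmp => //.
  by apply: continuousB => //; exact: cvg_cst.
have main l : is_derive s0 1 (fun s => v (Y l s) (T s))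
    (w None (X s0) (T s0) * T' + \sum_(i <- l) w (Some i) (X s0) (T s0) * X' i).
  elim: l => [|i l IH].
    rewrite big_nil addr0 /Y.
    rewrite (_ : (fun s => _) = v (X s0) \o T); last first.
      by apply/funext => s; rewrite big_nil addr0.
    exact: is_derive1_comp (dt _ _ T0) dT.
  rewrite big_cons addrCA addrC.
  (* The value [a = X s0 0 i] leaves coordinate [i] frozen, while [a = X s 0 i] turns [Y l] into
     [Y (i :: l)]. *)
  pose G a s := v (Y l s - X s0 0 i *: evec R i + a *: evec R i) (T s).
  pose dG a s := w (Some i) (Y l s - X s0 0 i *: evec R i + a *: evec R i) (T s).
  have G0 s : G (X s0 0 i) s = v (Y l s) (T s) by rewrite /G subrK.
  rewrite (_ : (fun s => _) = fun s => G (X s 0 i) s); last first.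
    apply/funext => s; rewrite /G /Y big_cons; congr (v _ _).
    set a := X s 0 i *: _; set b := X s0 0 i *: _.
    by rewrite scalerBl -/a -/b (addrC (a - b)) addrA (addrC a) addrA.
  have -> : w (Some i) (X s0) (T s0) * X' i = dG (X s0 0 i) s0 * X' i.
    by rewrite /dG subrK Ys0.
  apply: is_derive_two_args => //; last first.
    by rewrite (_ : G _ = fun s => v (Y l s) (T s))//; exact/funext.
  - apply: (@continuous_comp _ _ _
     (fun p : R * R => (Y l p.2 - X s0 0 i *: evec R i + p.1 *: evec R i, T p.2))
     (fun q : 'rV[R]_n * R => w (Some i) q.1 q.2)); last exact: cw.
    have c2 : {for (X s0 0 i, s0), continuous (fun p : R * R => p.2)} by exact: cvg_snd.
    apply: continuous_pair; last exact: (continuous_comp c2 cT).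
    apply: continuousD; last first.
      by apply: continuousZr_tmp; exact: cvg_fst.
    apply: continuousB; last exact: cvg_cst.
    exact: (continuous_comp c2 (cY l)).
  - have := cvgr_gt _ cT _ T0 => nT.
    exists ([set: R], [set s | 0 < T s]); first by (split => /=; [exact: filterT|exact: nT]).
    move=> [a s]/= [_ Ts]; rewrite /G /dG.
    exact: dx.
rewrite (_ : (fun s => v (X s) (T s)) = fun s => v (Y (index_enum 'I_n) s) (T s)) //.
apply/funext => s; congr (v _ _); rewrite /Y.
under eq_bigr do rewrite scalerBl.
rewrite sumrB; rewrite /evec -!row_sum_delta addrC subrK//.
Qed.

End Partials.

(** * The spherical frame *)

Section PointwiseContinuity.
Context {R : realType} {T : topologicalType}.
Implicit Types f g : T -> R.

Lemma continuousM_fun f g :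
  continuous f -> continuous g -> continuous (fun a => f a * g a).
Proof. by move=> cf cg a; apply: continuousM; [exact: cf|exact: cg]. Qed.

Lemma continuousD_fun f g :
  continuous f -> continuous g -> continuous (fun a => f a + g a).
Proof. by move=> cf cg a; apply: continuousD; [exact: cf|exact: cg]. Qed.

Lemma continuousN_fun f : continuous f -> continuous (fun a => - f a).
Proof. by move=> cf a; apply: continuousN; exact: cf. Qed.

End PointwiseContinuity.

Lemma continuous_sum {R : realType} {T : topologicalType} {V : normedModType R}
    (I : Type) (l : seq I) (f : I -> T -> V) :
  (forall i, continuous (f i)) -> continuous (fun x => \sum_(i <- l) f i x).
Proof.
move=> cf; elim: l => [|i l IH].
  rewrite (_ : (fun x => _) = cst 0); first by move=> x; exact: cvg_cst.
  by apply/funext => x; rewrite big_nil.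
rewrite (_ : (fun x => _) = fun x => f i x + \sum_(i <- l) f i x).
  by move=> x; apply: continuousD; [exact: cf|exact: IH].
by apply/funext => x; rewrite big_cons.
Qed.

Lemma continuous_row {R : realType} {n : nat} {T : topologicalType}
    (c : 'I_n -> T -> R) :
  (forall i, continuous (c i)) -> continuous (fun x => \row_i c i x : 'rV[R]_n).
Proof.
move=> cc; rewrite (_ : (fun x => _) = fun x => \sum_i c i x *: evec R i).
  by apply: continuous_sum => i x; apply: continuousZr_tmp; exact: cc.
by apply/funext => x; rewrite [LHS]row_sum_delta; apply: eq_bigr => i _; rewrite mxE.
Qed.

Section SphericalFrame.
Context {R : realType} {n : nat}.
Implicit Types th ph : R.

(* The first n coordinates of the spherical frame of R^3; for n = 2 this is the
   method of descent. *)
Definition radial th ph : 'rV[R]_n :=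
  \row_i [:: sin th * cos ph; sin th * sin ph; cos th]`_i.
Definition polar th ph : 'rV[R]_n :=
  \row_i [:: cos th * cos ph; cos th * sin ph; - sin th]`_i.
Definition azimuthal ph : 'rV[R]_n := \row_i [:: - sin ph; cos ph; 0]`_i.
(** This vector is both minus the derivative of [azimuthal] and [sin th * radial + cos th * polar].
    It therefore appears in the derivatives of both angular fluxes. *)
Definition horizontal ph : 'rV[R]_n := \row_i [:: cos ph; sin ph; 0]`_i.

(** Orthonormality is stated for the coordinates, as a resolution of the identity, because this form
    survives truncation to the first [n] coordinates. For [n = 2] the truncated frame vectors
    themselves are no longer orthonormal. *)
Lemma frame_orthonormal th ph (i j : 'I_n) : (n <= 3)%N ->
  radial th ph 0 i * radial th ph 0 j + polar th ph 0 i * polar th ph 0 j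
  + azimuthal ph 0 i * azimuthal ph 0 j = (i == j)%:R.
Proof.
move=> n3; rewrite !mxE -val_eqE/=.
have i3 := leq_trans (ltn_ord i) n3; have j3 := leq_trans (ltn_ord j) n3.
have E1 := cos2Dsin2 th; have E2 := cos2Dsin2 ph.
have F z : (cos th ^+ 2 + sin th ^+ 2) * z = z by rewrite E1 mul1r.
have F1 := F (cos ph ^+ 2); have F2 := F (sin ph ^+ 2); have F3 := F (cos ph * sin ph).
by move: (i : nat) (j : nat) i3 j3 => [|[|[|//]]] [|[|[|//]]] _ _ /=; lra.
Qed.


Lemma is_derive_ext {f g : R -> R} {x a b : R} :
  is_derive x 1 f a -> f = g -> a = b -> is_derive x 1 g b.
Proof. by move=> fa <- <-. Qed.

Lemma is_derive_radial_th th ph i :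
  is_derive th 1 (fun th => radial th ph 0 i) (polar th ph 0 i).
Proof.
rewrite (_ : (fun th => _) = fun th => [:: sin th * cos ph; sin th * sin ph; cos th]`_i);
  last by apply/funext => z; rewrite mxE.
rewrite mxE; case: (i : nat) => [|[|[|k]]] /=.
- apply: (is_derive_ext (is_deriveZ (cos ph) (is_derive_sin th))).
    by apply/funext => z; rewrite /GRing.scale/= mulrC.
  by rewrite /GRing.scale/= mulrC.
- apply: (is_derive_ext (is_deriveZ (sin ph) (is_derive_sin th))).
    by apply/funext => z; rewrite /GRing.scale/= mulrC.
  by rewrite /GRing.scale/= mulrC.
- exact: is_derive_cos.
- by rewrite !nth_nil; exact: is_derive_cst.
Qed.

Lemma is_derive_radial_ph th ph i :
  is_derive ph 1 (fun ph => radial th ph 0 i) (sin th * azimuthal ph 0 i).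
Proof.
rewrite (_ : (fun ph => _) = fun ph => [:: sin th * cos ph; sin th * sin ph; cos th]`_i);
  last by apply/funext => z; rewrite mxE.
rewrite mxE; case: (i : nat) => [|[|[|k]]] /=.
- exact: (is_deriveZ (sin th) (is_derive_cos ph)).
- exact: (is_deriveZ (sin th) (is_derive_sin ph)).
- by rewrite mulr0; exact: is_derive_cst.
- by rewrite !nth_nil mulr0; exact: is_derive_cst.
Qed.

Lemma is_derive_azimuthal ph i :
  is_derive ph 1 (fun ph => azimuthal ph 0 i) (- horizontal ph 0 i).
Proof.
rewrite (_ : (fun ph => _) = fun ph => [:: - sin ph; cos ph; 0]`_i);
  last by apply/funext => z; rewrite mxE.
rewrite mxE; case: (i : nat) => [|[|[|k]]] /=.
- exact: (is_deriveN (is_derive_sin ph)).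
- exact: is_derive_cos.
- by rewrite oppr0; exact: is_derive_cst.
- by rewrite !nth_nil oppr0; exact: is_derive_cst.
Qed.

Lemma is_derive_sin_polar th ph i :
  is_derive th 1 (fun th => sin th * polar th ph 0 i)
    (- (2 * (sin th * radial th ph 0 i)) + horizontal ph 0 i).
Proof.
have dp : is_derive th 1 (fun th => polar th ph 0 i)
    (- radial th ph 0 i).
  rewrite (_ : (fun th => _) = fun th => [:: cos th * cos ph; cos th * sin ph; - sin th]`_i);
    last by apply/funext => z; rewrite mxE.
  rewrite mxE; case: (i : nat) => [|[|[|k]]] /=.
  - apply: (is_derive_ext (is_deriveZ (cos ph) (is_derive_cos th))).
      by apply/funext => z; rewrite /GRing.scale/= mulrC.
    by rewrite /GRing.scale/=; ring.
  - apply: (is_derive_ext (is_deriveZ (sin ph) (is_derive_cos th))).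
      by apply/funext => z; rewrite /GRing.scale/= mulrC.
    by rewrite /GRing.scale/=; ring.
  - exact: (is_deriveN (is_derive_sin th)).
  - by rewrite !nth_nil oppr0; exact: is_derive_cst.
apply: (is_derive_ext (is_deriveM (is_derive_sin th) dp)); first by apply/funext.
rewrite /GRing.scale/= !mxE.
have E1 := cos2Dsin2 th.
have F z : (cos th ^+ 2 + sin th ^+ 2) * z = z by rewrite E1 mul1r.
have F1 := F (cos ph); have F2 := F (sin ph).
case: (i : nat) => [|[|[|k]]] /=; rewrite ?nth_nil; lra.
Qed.

Lemma continuous_frame :
  [/\ continuous (fun a : R * R => radial a.1 a.2),
      continuous (fun a : R * R => polar a.1 a.2),
      continuous azimuthal & continuous horizontal].
Proof.
have c1 (f : R -> R) : continuous f -> continuous (fun a : R * R => f a.1).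
  by move=> cf a; apply: (@continuous_comp _ _ _ fst f); [exact: cvg_fst|exact: cf].
have c2 (f : R -> R) : continuous f -> continuous (fun a : R * R => f a.2).
  by move=> cf a; apply: (@continuous_comp _ _ _ snd f); [exact: cvg_snd|exact: cf].
have cs := @continuous_sin R; have cc := @continuous_cos R.
have c0 (T : topologicalType) (f : T -> R) : (forall x, f x = 0) -> continuous f.
  by move=> f0; rewrite (_ : f = cst 0); [move=> ?; exact: cvg_cst|exact/funext].
have cn (T : topologicalType) k : continuous (fun _ : T => ([::] : seq R)`_k).
  by apply: c0 => ?; rewrite nth_nil.
split; apply: continuous_row => i; case: (i : nat) => [|[|[|k]]] /=.
- by apply: continuousM_fun; [exact: c1|exact: c2].
- by apply: continuousM_fun; [exact: c1|exact: c2].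
- exact: c1.
- exact: cn.
- by apply: continuousM_fun; [exact: c1|exact: c2].
- by apply: continuousM_fun; [exact: c1|exact: c2].
- by apply: continuousN_fun; exact: c1.
- exact: cn.
- exact: continuousN_fun.
- exact: cc.
- exact: c0.
- exact: cn.
- exact: cc.
- exact: cs.
- exact: c0.
- exact: cn.
Qed.

End SphericalFrame.

(** * Fluxes along a characteristic cone *)

Section Cone.
Context {R : realType} {n : nat}.
Variables (u : 'rV[R]_n -> R -> R) (D1 : option 'I_n -> 'rV[R]_n -> R -> R)
  (D2 : option 'I_n -> option 'I_n -> 'rV[R]_n -> R -> R).
Hypotheses (cu : continuous (fun p : 'rV[R]_n * R => u p.1 p.2))
  (pu : has_partials u D1) (pD1 : forall k, has_partials (D1 k) (D2 k)).

(** The radial derivative of the flux produces the two mixed derivatives with opposite signs; this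
    equality makes them cancel. *)
Lemma mixed_partials_time_space i x t :
  0 < t -> D2 (Some i) None x t = D2 None (Some i) x t.
Proof.
move=> t0.
have cline (w : 'rV[R]_n -> R -> R) : continuous (fun p : 'rV[R]_n * R => w p.1 p.2) ->
    {for (0, t), continuous (fun p : R * R => w (x + p.1 *: evec R i) p.2)}.
  move=> cw; apply: (@continuous_comp _ _ _ (fun p : R * R => (x + p.1 *: evec R i, p.2))
    (fun q => w q.1 q.2)); last exact: cw.
  apply: continuous_pair; last exact: cvg_snd.
  apply: continuousD; first exact: cvg_cst.
  by apply: continuousZr_tmp; exact: cvg_fst.
have [_ du1 du2] := pu.
have := @mixed_partials R (fun a b => u (x + a *: evec R i) b)
  (fun a b => D1 (Some i) (x + a *: evec R i) b) (fun a b => D1 None (x + a *: evec R i) b)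
  (fun a b => D2 (Some i) None (x + a *: evec R i) b)
  (fun a b => D2 None (Some i) (x + a *: evec R i) b) 0 t t t0.
rewrite scale0r addr0; apply.
- move=> a b _; rewrite ltr_norml => /andP[b0 _].
  have {}b0 : 0 < b by lra.
  have [_ _ d3] := pD1 (Some i); have [_ d4 _] := pD1 None.
  by split; [exact: du1|exact: du2|exact: d3|exact: d4].
- by apply: cline; have [] := pD1 (Some i).
- by apply: cline; have [] := pD1 None.
Qed.

Variables (x0 : 'rV[R]_n) (t0 : R).
Implicit Types (r th ph : R) (v : 'rV[R]_n -> R -> R) (w : option 'I_n -> 'rV[R]_n -> R -> R).

Definition on_cone v r th ph := v (x0 + r *: radial th ph) (t0 - r).

Lemma continuous_on_cone v : continuous (fun p : 'rV[R]_n * R => v p.1 p.2) ->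
  continuous (fun a : R * R * R => on_cone v a.1.1 a.1.2 a.2).
Proof.
move=> cv a.
have c11 : {for a, continuous (fun a : R * R * R => a.1.1)}.
  by apply: (@continuous_comp _ _ _ fst fst); exact: cvg_fst.
have c12 : {for a, continuous (fun a : R * R * R => a.1.2)}.
  by apply: (@continuous_comp _ _ _ fst snd); [exact: cvg_fst|exact: cvg_snd].
apply: (@continuous_comp _ _ _
  (fun a : R * R * R => (x0 + a.1.1 *: radial a.1.2 a.2, t0 - a.1.1))
  (fun q : 'rV[R]_n * R => v q.1 q.2)); last exact: cv.
apply: continuous_pair.
  apply: continuousD; first exact: cvg_cst.
  have c2 : {for a, continuous (fun a : R * R * R => a.2)} by exact: cvg_snd.
  have [cr _ _ _] := @continuous_frame R n.
  apply: continuousZ; first exact: c11.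
  exact: (@continuous_comp _ _ _ _ _ a (continuous_pair _ _ a c12 c2) (cr _)).
by apply: continuousB => //; exact: cvg_cst.
Qed.

Lemma is_derive_on_cone_r {v w} r th ph : has_partials v w -> r < t0 ->
  is_derive r 1 (fun r => on_cone v r th ph)
    (- on_cone (w None) r th ph
     + \sum_i on_cone (w (Some i)) r th ph * radial th ph 0 i).
Proof.
move=> vw rt.
have := @chain_rule R n v w (fun r => x0 + r *: radial th ph) (fun r => t0 - r) r (-1)
  (fun i => radial th ph 0 i) vw _ _ _.
rewrite mulrN1; apply; first by lra.
- move=> i.
  apply: (is_derive_ext (is_deriveD (is_derive_cst (x0 0 i) r 1)
      (is_deriveZ (radial th ph 0 i) (is_derive_id r 1)))).
    by apply/funext => z; rewrite [RHS]mxE [X in _ = _ + X]mxE mulrC.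
  by rewrite add0r /GRing.scale/= mulr1.
- apply: (is_derive_ext (is_deriveB (is_derive_cst t0 r 1) (is_derive_id r 1))) => //.
  by rewrite sub0r.
Qed.

Lemma is_derive_on_cone_th {v w} r th ph : has_partials v w -> r < t0 ->
  is_derive th 1 (fun th => on_cone v r th ph)
    (\sum_i on_cone (w (Some i)) r th ph * (r * polar th ph 0 i)).
Proof.
move=> vw rt.
have := @chain_rule R n v w (fun th => x0 + r *: radial th ph) (fun=> t0 - r) th 0
  (fun i => r * polar th ph 0 i) vw _ _ _.
rewrite mulr0 add0r; apply; first by lra.
- move=> i.
  apply: (is_derive_ext (is_deriveD (is_derive_cst (x0 0 i) th 1)
      (is_deriveZ r (is_derive_radial_th th ph i)))).
    by apply/funext => z; rewrite [RHS]mxE [X in _ = _ + X]mxE.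
  by rewrite add0r.
Qed.

Lemma is_derive_on_cone_ph {v w} r th ph : has_partials v w -> r < t0 ->
  is_derive ph 1 (fun ph => on_cone v r th ph)
    (\sum_i on_cone (w (Some i)) r th ph * (r * (sin th * azimuthal ph 0 i))).
Proof.
move=> vw rt.
have := @chain_rule R n v w (fun ph => x0 + r *: radial th ph) (fun=> t0 - r) ph 0
  (fun i => r * (sin th * azimuthal ph 0 i)) vw _ _ _.
rewrite mulr0 add0r; apply; first by lra.
- move=> i.
  apply: (is_derive_ext (is_deriveD (is_derive_cst (x0 0 i) ph 1)
      (is_deriveZ r (is_derive_radial_ph th ph i)))).
    by apply/funext => z; rewrite [RHS]mxE [X in _ = _ + X]mxE.
  by rewrite add0r.
Qed.

(* With U(r, th, ph) = u(x0 + r om, t0 - r), the flux is sin th times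
   (d/dr + d/dt)(r u); together with the two angular fields it forms a vector
   field whose divergence is r sin th (Laplacian u - u_tt). *)
Definition radial_flux r th ph :=
  sin th * (on_cone u r th ph + r * (\sum_i radial th ph 0 i * on_cone (D1 (Some i)) r th ph
                                     + on_cone (D1 None) r th ph)).
Definition polar_flux r th ph :=
  \sum_i (sin th * polar th ph 0 i) * on_cone (D1 (Some i)) r th ph.
Definition azimuthal_flux r th ph :=
  \sum_i azimuthal ph 0 i * on_cone (D1 (Some i)) r th ph.
(** The angular derivatives are kept in product-rule form, which makes their joint continuity a
    matter of sums and products. *)
Definition d_polar_flux r th ph :=
  \sum_i ((sin th * polar th ph 0 i) *
            (\sum_j on_cone (D2 (Some i) (Some j)) r th ph * (r * polar th ph 0 j))
          + on_cone (D1 (Some i)) r th ph *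
            (- (2 * (sin th * radial th ph 0 i)) + horizontal ph 0 i)).
Definition d_azimuthal_flux r th ph :=
  \sum_i (azimuthal ph 0 i *
            (\sum_j on_cone (D2 (Some i) (Some j)) r th ph * (r * (sin th * azimuthal ph 0 j)))
          + on_cone (D1 (Some i)) r th ph * - horizontal ph 0 i).

Lemma is_derive_sum_fun {h : 'I_n -> R -> R} {dh : 'I_n -> R} {x : R} :
  (forall i, is_derive x 1 (h i) (dh i)) ->
  is_derive x 1 (fun y => \sum_i h i y) (\sum_i dh i).
Proof.
move=> H; apply: (is_derive_ext (is_derive_sum H)) => //.
by apply/funext => y; rewrite fct_sumE.
Qed.

Lemma is_derive_polar_flux r th ph : r < t0 ->
  is_derive th 1 (fun th => polar_flux r th ph) (d_polar_flux r th ph).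
Proof.
move=> rt; apply: is_derive_sum_fun => i.
by apply: (is_derive_ext (is_deriveM (is_derive_sin_polar th ph i) (is_derive_on_cone_th r th ph (pD1 (Some i)) rt))).
Qed.

Lemma is_derive_azimuthal_flux r th ph : r < t0 ->
  is_derive ph 1 (fun ph => azimuthal_flux r th ph) (d_azimuthal_flux r th ph).
Proof.
move=> rt; apply: is_derive_sum_fun => i.
by apply: (is_derive_ext (is_deriveM (is_derive_azimuthal ph i) (is_derive_on_cone_ph r th ph (pD1 (Some i)) rt))).
Qed.

(** The divergence identity. The three fields contribute the Hessian of [u] along the three frame
    directions, which add up to the Laplacian by [frame_orthonormal]; the first-order terms and the
    mixed space-time terms cancel. *)
Lemma is_derive_radial_flux r th ph : (n <= 3)%N -> r < t0 ->
  is_derive r 1 (fun r => radial_flux r th ph)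
    (r * sin th * (\sum_i on_cone (D2 (Some i) (Some i)) r th ph
                   - on_cone (D2 None None) r th ph)
     - d_polar_flux r th ph - d_azimuthal_flux r th ph).
Proof.
move=> n3 rt.
have dsum := is_derive_sum_fun (fun i => is_deriveZ (radial th ph 0 i) (is_derive_on_cone_r r th ph (pD1 (Some i)) rt)).
have dr := is_deriveM (is_derive_id r 1)
  (is_deriveD dsum (is_derive_on_cone_r r th ph (pD1 None) rt)).
apply: (is_derive_ext (is_deriveZ (sin th) (is_deriveD (is_derive_on_cone_r r th ph pu rt) dr))) => //.
have tr : 0 < t0 - r by lra.
have sym i : on_cone (D2 (Some i) None) r th ph = on_cone (D2 None (Some i)) r th ph.
  exact: mixed_partials_time_space.
set L := \sum_i on_cone (D2 (Some i) (Some i)) r th ph.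
pose m i j := on_cone (D2 (Some i) (Some j)) r th ph.
pose A := \sum_i on_cone (D1 (Some i)) r th ph * radial th ph 0 i.
pose B := \sum_i on_cone (D2 None (Some i)) r th ph * radial th ph 0 i.
pose H := \sum_i on_cone (D1 (Some i)) r th ph * horizontal ph 0 i.
(* The Hessian of [u] on the cone, as a quadratic form evaluated at [o]. *)
pose M (o : 'rV[R]_n) := \sum_i \sum_j m i j * (o 0 i * o 0 j).
have EL : M (radial th ph) + M (polar th ph) + M (azimuthal ph) = L.
  rewrite -!big_split/=; apply: eq_bigr => i _.
  rewrite -!big_split/= (bigD1 i)//= -!mulrDr frame_orthonormal// eqxx mulr1.
  rewrite big1 ?addr0// => j /negbTE ji.
  by rewrite -!mulrDr frame_orthonormal// eq_sym ji mulr0.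
have EP : d_polar_flux r th ph = r * sin th * M (polar th ph) - 2 * sin th * A + H.
  rewrite /A /H /M !mulr_sumr -sumrB -big_split; apply: eq_bigr => i _ /=.
  rewrite !mulr_sumr (eq_bigr (fun j => r * sin th * (m i j * (polar th ph 0 i * polar th ph 0 j)))).
    by ring.
  by move=> j _; rewrite /m; ring.
have EZ : d_azimuthal_flux r th ph = r * sin th * M (azimuthal ph) - H.
  rewrite /H /M !mulr_sumr -sumrB; apply: eq_bigr => i _ /=.
  rewrite !mulr_sumr (eq_bigr (fun j => r * sin th * (m i j * (azimuthal ph 0 i * azimuthal ph 0 j)))).
    by ring.
  by move=> j _; rewrite /m; ring.
have ER : \sum_i radial th ph 0 i * (- on_cone (D2 (Some i) None) r th ph
      + \sum_j on_cone (D2 (Some i) (Some j)) r th ph * radial th ph 0 j)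
    = M (radial th ph) - B.
  rewrite /M /B -sumrB; apply: eq_bigr => i _; rewrite sym mulrDr mulr_sumr addrC.
  congr (_ + _); last by ring.
  by apply: eq_bigr => j _; rewrite /m; ring.
have EA : \sum_i radial th ph 0 i * on_cone (D1 (Some i)) r th ph = A.
  by apply: eq_bigr => i _; rewrite mulrC.
rewrite EP EZ -EL.
transitivity (sin th * ((- on_cone (D1 None) r th ph + A)
    + (r * ((M (radial th ph) - B) + (- on_cone (D2 None None) r th ph + B))
       + (A + on_cone (D1 None) r th ph) * 1))); last by ring.
by rewrite -ER -{2}EA.
Qed.

End Cone.

(** * Euclidean norm and elementary estimates *)

Section EuclideanNorm.
Context {R : realType} {n : nat}.
Implicit Types x y : 'rV[R]_n.

Lemma enorm_ge0 x : 0 <= enorm x.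
Proof. exact: sqrtr_ge0. Qed.

Lemma sqr_enorm x : enorm x ^+ 2 = \sum_i x 0 i ^+ 2.
Proof. by rewrite sqr_sqrtr// sumr_ge0// => i _; exact: sqr_ge0. Qed.

(** Lagrange's identity: twice the gap between the squares of the two sides is the double sum of
    squares introduced below. *)
Lemma cauchy_schwarz x y : `|\sum_i x 0 i * y 0 i| <= enorm x * enorm y.
Proof.
rewrite -ler_sqr ?nnegrE ?normr_ge0 ?mulr_ge0 ?enorm_ge0// real_normK ?num_real//.
rewrite exprMn !sqr_enorm.
have : 0 <= \sum_i \sum_j (x 0 i * y 0 j - x 0 j * y 0 i) ^+ 2.
  by apply: sumr_ge0 => i _; apply: sumr_ge0 => j _; exact: sqr_ge0.
have -> : \sum_i \sum_j (x 0 i * y 0 j - x 0 j * y 0 i) ^+ 2 =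
    2 * ((\sum_i x 0 i ^+ 2) * (\sum_i y 0 i ^+ 2)) - 2 * (\sum_i x 0 i * y 0 i) ^+ 2.
  transitivity (\sum_i \sum_j (x 0 i ^+ 2 * y 0 j ^+ 2 + y 0 i ^+ 2 * x 0 j ^+ 2
      - 2 * ((x 0 i * y 0 i) * (x 0 j * y 0 j)))).
    by apply: eq_bigr => i _; apply: eq_bigr => j _; ring.
  under eq_bigr do rewrite sumrB big_split/= -!mulr_sumr.
  rewrite sumrB big_split/= -!mulr_suml -mulr_sumr -mulr_suml.
  by ring.
by lra.
Qed.

Lemma enormD x y : enorm (x + y) <= enorm x + enorm y.
Proof.
rewrite -ler_sqr ?nnegrE ?addr_ge0 ?enorm_ge0// sqr_enorm.
have /(le_trans (ler_norm _)) := cauchy_schwarz x y.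
have -> : \sum_i (x + y) 0 i ^+ 2 =
    \sum_i x 0 i ^+ 2 + \sum_i y 0 i ^+ 2 + 2 * \sum_i x 0 i * y 0 i.
  rewrite mulr_sumr -!big_split/=; apply: eq_bigr => i _; rewrite mxE; ring.
by rewrite -!sqr_enorm; lra.
Qed.

Lemma enormZ (a : R) x : enorm (a *: x) = `|a| * enorm x.
Proof.
rewrite /enorm -sqrtr_sqr -sqrtrM ?sqr_ge0// mulr_sumr.
by congr Num.sqrt; apply: eq_bigr => i _; rewrite mxE exprMn.
Qed.

Lemma enormN x : enorm (- x) = enorm x.
Proof. by rewrite -scaleN1r enormZ normrN normr1 mul1r. Qed.

Lemma continuous_enorm : continuous (@enorm R n).
Proof.
move=> x; apply: (@continuous_comp _ _ _ (fun x => \sum_i x 0 i ^+ 2) Num.sqrt).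
  apply: continuous_sum => i {}x.
  apply: (@continuous_comp _ _ _ (fun x : 'rV[R]_n => x 0 i) (fun a : R => a ^+ 2)).
    exact: coord_continuous.
  exact: exprn_continuous.
exact: sqrt_continuous.
Qed.

(** For [n = 3] the vector has norm 1; for [n = 2] the projection leaves norm [|sin th|]. *)
Lemma enorm_radial_le1 (th ph : R) : n = 2%N \/ n = 3%N -> enorm (radial th ph : 'rV[R]_n) <= 1.
Proof.
move=> hn; rewrite -[leRHS]sqrtr1 ler_wsqrtr//.
have E1 := cos2Dsin2 th; have E2 := cos2Dsin2 ph.
have F z : (cos th ^+ 2 + sin th ^+ 2) * z = z by rewrite E1 mul1r.
have F1 := F (cos ph ^+ 2); have F2 := F (sin ph ^+ 2).
have F3 : sin th ^+ 2 * (cos ph ^+ 2 + sin ph ^+ 2) = sin th ^+ 2 by rewrite E2 mulr1.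
have F4 := sqr_ge0 (cos th).
case: hn => n23; subst n; rewrite !big_ord_recl big_ord0 !mxE/=; lra.
Qed.

End EuclideanNorm.

(** Derivatives are compared in the open interval only: along the cone they are known for [r < t0],
    whereas continuity reaches the base [r = t0]. *)
Lemma increment_le {R : realType} (f g df dg : R -> R) (a b : R) : a <= b ->
  continuous f -> continuous g ->
  (forall x, a < x < b -> is_derive x 1 f (df x)) ->
  (forall x, a < x < b -> is_derive x 1 g (dg x)) ->
  (forall x, a < x < b -> df x <= dg x) ->
  f b - f a <= g b - g a.
Proof.
move=> ab cf cg Hf Hg Hle.
case: (ltgtP a b) ab => // [ab _|-> _]; last by rewrite !subrr.
have [||c] := @MVT R (f - g) (fun x => df x - dg x) a b ab.
- by move=> x; rewrite in_itv/= => xab; apply: is_deriveB; [exact: Hf|exact: Hg].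
- by apply: continuous_subspaceT => x; apply: continuousB; [exact: cf|exact: cg].
- rewrite in_itv/= => /Hle cab; rewrite !fctE => E.
  have : (df c - dg c) * (b - a) <= 0 by rewrite mulr_le0_ge0// subr_cp0//= ltW.
  by rewrite -E; lra.
Qed.

Lemma sin_lipschitz {R : realType} (x y : R) : `|sin x - sin y| <= `|y - x|.
Proof.
have [c _ E] := @mean_value R sin cos x y _.
rewrite distrC E normrM -[leRHS]mul1r ler_wpM2r//.
exact: cos_max.
Qed.

(** The integral of [sin] over [[0, pi]] is 2, and the Lipschitz bound makes the Riemann error at
    most [pi ^+ 2 / N.+1%:R <= 1], so the Riemann sum is at least 1. *)
Lemma sum_sin_ge {R : realType} (N : nat) : pi ^+ 2 <= N.+1%:R :> R ->
  N.+1%:R / pi <= \sum_(j < N.+1) sin (0 + j%:R * ((pi - 0) / N.+1%:R)) :> R.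
Proof.
move=> hN; have pi0 := @pi_gt0 R.
have N0 : 0 < N.+1%:R :> R by [].
have dcos x : 0 <= x <= pi -> is_derive x 1 (fun x : R => - cos x) (sin x).
  by move=> _; apply: (is_derive_ext (is_deriveN (is_derive_cos x))) => //; rewrite opprK.
have := @riemann_sum_error R (fun x => - cos x) sin 0 pi (pi / N.+1%:R) N (pi_ge0 R) dcos _.
set S := \sum_(_ < _) _.
rewrite cospi cos0 opprK subr0 ler_distl => H.
have {}H : 1 <= S * (pi / N.+1%:R).
  have /andP[+ _] := H (fun x y _ _ xy => le_trans (sin_lipschitz x y) xy).
  apply: le_trans; rewrite -addrA lerDl subr_ge0.
  by rewrite mulrAC ler_pdivrMr// mul1r -expr2.
rewrite ler_pdivrMr// -[leLHS]mul1r -ler_pdivlMr// -mulrA.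
exact: H.
Qed.

(** * Continuity of the fluxes and of their angular derivatives *)

Section ConeBound.
Context {R : realType} {n : nat}.
Variables (u : 'rV[R]_n -> R -> R) (D1 : option 'I_n -> 'rV[R]_n -> R -> R)
  (D2 : option 'I_n -> option 'I_n -> 'rV[R]_n -> R -> R).
Hypotheses (cu : continuous (fun p : 'rV[R]_n * R => u p.1 p.2))
  (pu : has_partials u D1) (pD1 : forall k, has_partials (D1 k) (D2 k)).
Variables (x0 : 'rV[R]_n) (t0 : R).

Lemma continuous_radial_flux th ph : continuous (fun r => radial_flux u D1 x0 t0 r th ph).
Proof.
have c v : continuous (fun p : 'rV[R]_n * R => v p.1 p.2) ->
    continuous (fun r => on_cone x0 t0 v r th ph).
  move=> cv r; apply: (@continuous_comp _ _ _ (fun r => (r, th, ph))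
    (fun a : R * R * R => on_cone x0 t0 v a.1.1 a.1.2 a.2)); last exact: continuous_on_cone.
  apply: continuous_pair; last exact: cvg_cst.
  by apply: continuous_pair; [exact: cvg_id|exact: cvg_cst].
have [cD1 _ _] := pu.
have ccst (a : R) : continuous (fun _ : R => a) by move=> ?; exact: cvg_cst.
rewrite /radial_flux; apply: continuousM_fun => //.
apply: continuousD_fun; first exact: c.
apply: continuousM_fun; first by move=> ?; exact: cvg_id.
apply: continuousD_fun; last by apply: c; exact: cD1.
by apply: continuous_sum => i; apply: continuousM_fun => //; apply: c; exact: cD1.
Qed.

Let coefficient_continuity :
  [/\ forall i : 'I_n, continuous (fun a : R * R * R => (radial a.1.2 a.2 : 'rV[R]_n) 0 i),
      forall i : 'I_n, continuous (fun a : R * R * R => (polar a.1.2 a.2 : 'rV[R]_n) 0 i),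
      forall i : 'I_n, continuous (fun a : R * R * R => (azimuthal a.2 : 'rV[R]_n) 0 i),
      forall i : 'I_n, continuous (fun a : R * R * R => (horizontal a.2 : 'rV[R]_n) 0 i) &
      continuous (fun a : R * R * R => a.1.1) /\ continuous (fun a : R * R * R => sin a.1.2)].
Proof.
have [cr cp ca ch] := @continuous_frame R n.
have c11 : continuous (fun a : R * R * R => a.1.1).
  by move=> a; apply: (@continuous_comp _ _ _ fst fst); exact: cvg_fst.
have c12 : continuous (fun a : R * R * R => a.1.2).
  by move=> a; apply: (@continuous_comp _ _ _ fst snd); [exact: cvg_fst|exact: cvg_snd].
have c2 : continuous (fun a : R * R * R => a.2) by move=> a; exact: cvg_snd.
have cc := @coord_continuous R 1 n 0.
have c3 : continuous (fun a : R * R * R => (a.1.2, a.2)).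
  by move=> a; exact: (continuous_pair _ _ a (c12 a) (c2 a)).
split=> [i a|i a|i a|i a|].
- exact: (@continuous_comp _ _ _ _ _ a (@continuous_comp _ _ _ _ _ a (c3 a) (cr _)) (cc i _)).
- exact: (@continuous_comp _ _ _ _ _ a (@continuous_comp _ _ _ _ _ a (c3 a) (cp _)) (cc i _)).
- exact: (@continuous_comp _ _ _ _ _ a (@continuous_comp _ _ _ _ _ a (c2 a) (ca _)) (cc i _)).
- exact: (@continuous_comp _ _ _ _ _ a (@continuous_comp _ _ _ _ _ a (c2 a) (ch _)) (cc i _)).
- split => // a.
  exact: (@continuous_comp _ _ _ _ _ a (c12 a) (@continuous_sin R _)).
Qed.

Lemma continuous_d_polar_flux : continuous (fun a : R * R * R =>
  d_polar_flux D1 D2 x0 t0 a.1.1 a.1.2 a.2).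
Proof.
have [cr cp ca ch [c1 cs]] := coefficient_continuity.
have [cD1 _ _] := pu.
have cD2 k l : continuous (fun p : 'rV[R]_n * R => D2 k l p.1 p.2) by have [] := pD1 k.
apply: continuous_sum => i; apply: continuousD_fun; apply: continuousM_fun.
- exact: continuousM_fun.
- apply: continuous_sum => j; apply: continuousM_fun; last exact: continuousM_fun.
  exact: continuous_on_cone.
- exact: continuous_on_cone.
- apply: continuousD_fun => //; apply: continuousN_fun; apply: continuousM_fun.
    by move=> a; exact: cvg_cst.
  exact: continuousM_fun.
Qed.

Lemma continuous_d_azimuthal_flux : continuous (fun a : R * R * R =>
  d_azimuthal_flux D1 D2 x0 t0 a.1.1 a.1.2 a.2).
Proof.
have [cr cp ca ch [c1 cs]] := coefficient_continuity.
have [cD1 _ _] := pu.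
have cD2 k l : continuous (fun p : 'rV[R]_n * R => D2 k l p.1 p.2) by have [] := pD1 k.
apply: continuous_sum => i; apply: continuousD_fun; apply: continuousM_fun.
- exact: ca.
- apply: continuous_sum => j; apply: continuousM_fun; first exact: continuous_on_cone.
  by apply: continuousM_fun => //; exact: continuousM_fun.
- exact: continuous_on_cone.
- by apply: continuousN_fun.
Qed.

End ConeBound.

(** * Kirchhoff's lower bound *)

Lemma is_derive_quadratic {R : realType} (c d r : R) :
  is_derive r 1 (fun r => c * r ^+ 2 + d * r) (2 * c * r + d).
Proof.
apply: (is_derive_ext (is_deriveD (is_deriveZ c (is_deriveX 2 (is_derive_id r 1)))
  (is_deriveZ d (is_derive_id r 1)))) => //.
by rewrite /GRing.scale/= expr1; ring.
Qed.

Lemma continuous_quadratic {R : realType} (c d : R) :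
  continuous (fun r : R => c * r ^+ 2 + d * r).
Proof.
move=> r; apply/differentiable_continuous; rewrite -derivable1_diffP.
by case: (is_derive_quadratic c d r).
Qed.

Section ConeLowerBound.
Context {R : realType} {n : nat}.
Variables (u : 'rV[R]_n -> R -> R) (D1 : option 'I_n -> 'rV[R]_n -> R -> R)
  (D2 : option 'I_n -> option 'I_n -> 'rV[R]_n -> R -> R) (F : R -> R).
Hypotheses (hn : n = 2%N \/ n = 3%N)
  (cu : continuous (fun p : 'rV[R]_n * R => u p.1 p.2))
  (pu : has_partials u D1) (pD1 : forall k, has_partials (D1 k) (D2 k))
  (wave : forall x t, 0 < t ->
     D2 None None x t - \sum_i D2 (Some i) (Some i) x t = F (u x t)).

Let n3 : (n <= 3)%N. Proof. by case: hn => ->. Qed.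

Lemma enorm_ray_le (x0 : 'rV[R]_n) (r th ph : R) : 0 <= r ->
  enorm (x0 + r *: radial th ph - x0) <= r.
Proof.
move=> r0; rewrite addrC addKr enormZ ger0_norm// ler_piMr//.
exact: enorm_radial_le1.
Qed.

(** The flux is summed over a grid of angles and followed from the apex [r = 0], where it is a
    multiple of [u x0 t0], to the base [r = t0], where the data bound it below. Its decrease in [r]
    is governed by [F], up to angular sums that a fine grid makes small. *)
Lemma cone_lower_bound (x0 : 'rV[R]_n) (t0 s0 B l : R) :
  0 < t0 -> 0 <= s0 <= t0 ->
  (forall x s, 0 < s < t0 -> enorm (x - x0) <= t0 - s -> 0 <= F (u x s)) ->
  (forall x s, s0 < s < t0 -> enorm (x - x0) <= t0 - s -> B <= F (u x s)) ->
  (forall x, enorm (x - x0) <= t0 ->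
     l <= u x 0 - t0 * enorm (\row_i D1 (Some i) x 0) + t0 * D1 None x 0) ->
  l + B * (t0 - s0) ^+ 2 / 2 <= u x0 t0.
Proof.
move=> t0_gt0 /andP[s0_ge0 s0_le] F_ge0 F_geB data.
have pi0 := @pi_gt0 R.
apply/ler_addgt0Pr => e0 e0_gt0.
(* The two angular errors add up to at most [2 * e * N.+1%:R ^+ 2 * t0], and the total weight [s] is
   at least [N.+1%:R ^+ 2 / pi]; their ratio is at most [e0]. *)
pose e := e0 / (2 * pi * t0).
have den0 : 0 < 2 * pi * t0 by rewrite !mulr_gt0.
have e_gt0 : 0 < e by rewrite divr_gt0.
pose K : set (R * R * R) := (`[0, t0] `*` `[0, pi]) `*` `[0, pi *+ 2].
have cK : compact K.
  by apply: compact_setX; [apply: compact_setX|]; exact: segment_compact.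
have [d1 d1_gt0 osc1] := compact_uniform_continuity K _ e cK
  (continuous_d_polar_flux u D1 D2 pu pD1 x0 t0) e_gt0.
have [d2 d2_gt0 osc2] := compact_uniform_continuity K _ e cK
  (continuous_d_azimuthal_flux u D1 D2 pu pD1 x0 t0) e_gt0.
have m0 : 0 < Num.min d1 d2 by rewrite lt_min d1_gt0.
(* The grid is fine enough for [sum_sin_ge] and for both moduli of continuity; the azimuthal step,
   twice the polar one, is the binding one. *)
have [N [N_pi N_osc]] : exists N : nat, pi ^+ 2 <= N.+1%:R :> R /\
    (pi *+ 2) / N.+1%:R < Num.min d1 d2.
  pose z := pi ^+ 2 + (pi *+ 2) / Num.min d1 d2.
  have z1 : 0 <= (pi *+ 2) / Num.min d1 d2 by apply: divr_ge0; [apply: mulrn_wge0; exact: pi_ge0 | exact: ltW].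
  have z2 : 0 <= pi ^+ 2 :> R by exact: sqr_ge0.
  have z0 : 0 <= z by rewrite addr_ge0.
  exists (Num.bound z); have := archi_boundP z0 => zN.
  have zN1 : z < (Num.bound z).+1%:R by rewrite (lt_trans zN)// ltr_nat.
  split; first by apply: le_trans (ltW zN1); rewrite lerDl.
  rewrite ltr_pdivrMr// mulrC -ltr_pdivrMr//.
  by apply: le_lt_trans zN1; rewrite lerDr.
have N0 : 0 < N.+1%:R :> R by [].
pose c1 : R := (pi - 0) / N.+1%:R; pose c2 : R := (pi *+ 2 - 0) / N.+1%:R.
have pi2_gt0 : 0 < pi *+ 2 :> R by rewrite mulr2n addr_gt0.
have c1_gt0 : 0 < c1 by rewrite /c1 subr0 divr_gt0.
have c2_gt0 : 0 < c2 by rewrite /c2 subr0 divr_gt0.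
have c2d : c2 < Num.min d1 d2 by rewrite /c2 subr0.
have c1d : c1 < d1.
  have : c1 <= c2 by rewrite ler_pM2r ?invr_gt0// !subr0 mulr2n lerDl ltW.
  by move/le_lt_trans; apply; rewrite (lt_le_trans c2d)// ge_min lexx.
have {}c2d : c2 < d2 by rewrite (lt_le_trans c2d)// ge_min lexx orbT.
pose tht (j : 'I_N.+1) : R := 0 + j%:R * c1.
pose phi (k : 'I_N.+1) : R := 0 + k%:R * c2.
have tht_itv j : 0 <= tht j <= pi.
  rewrite /tht add0r mulr_ge0 ?(ltW c1_gt0)//= /c1 subr0 mulrA ler_pdivrMr// mulrC.
  by rewrite ler_wpM2l ?pi_ge0// ler_nat ltnW.
have phi_itv k : 0 <= phi k <= pi *+ 2.
  rewrite /phi add0r mulr_ge0 ?(ltW c2_gt0)//= /c2 subr0 mulrA ler_pdivrMr// mulrC.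
  by apply: ler_wpM2l; [exact: ltW|rewrite ler_nat ltnW].
have sin_tht j : 0 <= sin (tht j) by apply: sin_ge0_pi; exact: tht_itv.
pose S := \sum_j sin (tht j).
have S_ge : N.+1%:R / pi <= S by exact: sum_sin_ge.
have polar_err r ph : 0 < r < t0 -> 0 <= ph <= pi *+ 2 ->
    `|\sum_j d_polar_flux D1 D2 x0 t0 r (tht j) ph| <= e * N.+1%:R.
  move=> /andP[r0 rt] phb.
  (* The factor [sin th] vanishes at both poles. *)
  have Q0 : polar_flux D1 x0 t0 r pi ph - polar_flux D1 x0 t0 r 0 ph = 0.
    by rewrite /polar_flux !big1 ?subrr// => i _; rewrite ?sinpi ?sin0 !mul0r.
  suff : `|(\sum_j d_polar_flux D1 D2 x0 t0 r (tht j) ph) * c1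
      - (polar_flux D1 x0 t0 r pi ph - polar_flux D1 x0 t0 r 0 ph)| <= e * (pi - 0).
    rewrite Q0 [X in `|X|]subr0 normrM (gtr0_norm c1_gt0).
    have -> : e * (pi - 0) = e * N.+1%:R * c1.
      by rewrite -mulrA /c1 [N.+1%:R * _]mulrC divfK// pnatr_eq0.
    by rewrite ler_pM2r.
  apply: (@riemann_sum_error R (fun th => polar_flux D1 x0 t0 r th ph)
    (fun th => d_polar_flux D1 D2 x0 t0 r th ph)); first exact: pi_ge0.
    by move=> th _; exact: is_derive_polar_flux.
  move=> x y xb yb xy; apply/ltW; apply: (osc1 (r, x, ph) (r, y, ph)).
    by split; [split|]; rewrite /= in_itv/= ?xb ?phb ?(ltW r0) ?(ltW rt).
  split; [split|]; try exact: ballxx.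
  by rewrite /ball/= distrC (le_lt_trans xy).
have azimuthal_err r th : 0 < r < t0 -> 0 <= th <= pi ->
    `|\sum_k d_azimuthal_flux D1 D2 x0 t0 r th (phi k)| <= e * N.+1%:R.
  move=> /andP[r0 rt] thb.
  (* Periodicity in the azimuth. *)
  have Q0 : azimuthal_flux D1 x0 t0 r th (pi *+ 2) - azimuthal_flux D1 x0 t0 r th 0 = 0.
    rewrite /azimuthal_flux /on_cone /azimuthal /radial.
    by rewrite sin2pi cos2pi sin0 cos0 subrr.
  suff : `|(\sum_k d_azimuthal_flux D1 D2 x0 t0 r th (phi k)) * c2
      - (azimuthal_flux D1 x0 t0 r th (pi *+ 2) - azimuthal_flux D1 x0 t0 r th 0)|
      <= e * (pi *+ 2 - 0).
    rewrite Q0 [X in `|X|]subr0 normrM (gtr0_norm c2_gt0).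
    have -> : e * (pi *+ 2 - 0) = e * N.+1%:R * c2.
      by rewrite -mulrA /c2 [N.+1%:R * _]mulrC divfK// pnatr_eq0.
    by rewrite ler_pM2r.
  apply: (@riemann_sum_error R (fun ph => azimuthal_flux D1 x0 t0 r th ph)
    (fun ph => d_azimuthal_flux D1 D2 x0 t0 r th ph)); first exact: ltW.
    by move=> ph _; exact: is_derive_azimuthal_flux.
  move=> x y xb yb xy; apply/ltW; apply: (osc2 (r, th, x) (r, th, y)).
    by split; [split|]; rewrite /= in_itv/= ?xb ?thb ?(ltW r0) ?(ltW rt).
  split; [split|]; try exact: ballxx.
  by rewrite /ball/= distrC (le_lt_trans xy).
pose P r := \sum_j \sum_k radial_flux u D1 x0 t0 r (tht j) (phi k).
pose dP r := \sum_j \sum_k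
   (r * sin (tht j) * (\sum_i on_cone x0 t0 (D2 (Some i) (Some i)) r (tht j) (phi k)
                   - on_cone x0 t0 (D2 None None) r (tht j) (phi k))
     - d_polar_flux D1 D2 x0 t0 r (tht j) (phi k)
     - d_azimuthal_flux D1 D2 x0 t0 r (tht j) (phi k)).
have P_derive r : r < t0 -> is_derive r 1 P (dP r).
  move=> rt; apply: is_derive_sum_fun => j; apply: is_derive_sum_fun => k.
  exact: is_derive_radial_flux.
have P_cont : continuous P.
  apply: continuous_sum => j; apply: continuous_sum => k.
  exact: (continuous_radial_flux u D1 cu pu x0 t0 (tht j) (phi k)).
(* The total weight of the grid, playing the role of the area of the sphere. *)
pose s := N.+1%:R * S.
have dP_le b r : 0 < r < t0 ->
    (forall j k, b <= F (on_cone x0 t0 u r (tht j) (phi k))) ->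
    dP r <= - (b * s) * r + 2 * e * N.+1%:R ^+ 2.
  move=> r0t bF; have /andP[r0 rt] := r0t.
  have -> : dP r = \sum_j \sum_k - (r * sin (tht j) * F (on_cone x0 t0 u r (tht j) (phi k)))
     - \sum_j \sum_k d_polar_flux D1 D2 x0 t0 r (tht j) (phi k)
     - \sum_j \sum_k d_azimuthal_flux D1 D2 x0 t0 r (tht j) (phi k).
    rewrite -!sumrB; apply: eq_bigr => j _; rewrite -!sumrB; apply: eq_bigr => k _.
    congr (_ - _ - _); rewrite -mulrN; congr (_ * _).
    by rewrite /on_cone -wave ?opprB// subr_gt0.
  have E1 : \sum_j \sum_k - (r * sin (tht j) * F (on_cone x0 t0 u r (tht j) (phi k)))
      <= - (b * s) * r.
    apply: (@le_trans _ _ (\sum_j \sum_(k < N.+1) - (r * sin (tht j) * b))).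
      apply: ler_sum => j _; apply: ler_sum => k _.
      by rewrite lerN2 ler_wpM2l// mulr_ge0// ltW.
    under eq_bigr do rewrite sumr_const card_ord -mulr_natl.
    rewrite -mulr_sumr sumrN -mulr_suml -mulr_sumr -/S /s.
    by rewrite le_eqVlt; apply/orP; left; apply/eqP; ring.
  have E2 : `|\sum_j \sum_k d_polar_flux D1 D2 x0 t0 r (tht j) (phi k)| <= e * N.+1%:R ^+ 2.
    rewrite exchange_big/= (le_trans (ler_norm_sum _ _ _))//.
    apply: (@le_trans _ _ (\sum_(k < N.+1) e * N.+1%:R)).
      by apply: ler_sum => k _; exact: polar_err.
    by rewrite sumr_const card_ord -[e * _ *+ _]mulr_natr expr2 mulrA.
  have E3 : `|\sum_j \sum_k d_azimuthal_flux D1 D2 x0 t0 r (tht j) (phi k)| <= e * N.+1%:R ^+ 2.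
    rewrite (le_trans (ler_norm_sum _ _ _))//.
    apply: (@le_trans _ _ (\sum_(k < N.+1) e * N.+1%:R)).
      by apply: ler_sum => k _; exact: azimuthal_err.
    by rewrite sumr_const card_ord -[e * _ *+ _]mulr_natr expr2 mulrA.
  move: E2 E3; rewrite !ler_norml => /andP[E2 _] /andP[E3 _].
  move: E1 E2 E3; set X1 := \sum_j _; set X2 := \sum_j _; set X3 := \sum_j _.
  set X4 := N.+1%:R ^+ 2; lra.
have P0 : P 0 = s * u x0 t0.
  rewrite /P /s /S -mulrA mulr_suml mulr_sumr; apply: eq_bigr => j _.
  rewrite (eq_bigr (fun=> sin (tht j) * u x0 t0)).
    by rewrite sumr_const card_ord mulr_natl.
  by move=> k _; rewrite /radial_flux /on_cone scale0r addr0 subr0 mul0r addr0.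
(* On the base the directional derivative is at least minus the norm of the gradient, by
   Cauchy-Schwarz and [enorm_radial_le1]. *)
have Pt0 : s * l <= P t0.
  rewrite /P /s /S -mulrA mulr_suml mulr_sumr; apply: ler_sum => j _.
  rewrite mulr_natl -[X in _ *+ X](card_ord N.+1) -sumr_const; apply: ler_sum => k _.
  rewrite ler_wpM2l// /on_cone subrr.
  set x := x0 + _.
  have xt : enorm (x - x0) <= t0 by apply: enorm_ray_le; exact: ltW.
  apply: (le_trans (data x xt)).
  rewrite mulrDr addrA lerD2r lerD2l -mulrN ler_wpM2l ?(ltW t0_gt0)//.
  have := cauchy_schwarz (radial (tht j) (phi k)) (\row_i D1 (Some i) x 0).
  under eq_bigr do rewrite [X in _ * X]mxE.
  rewrite ler_norml => /andP[+ _]; apply: le_trans.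
  by rewrite lerN2 ler_piMl ?enorm_ge0// enorm_radial_le1.
(* Radius [r] corresponds to time [t0 - r], so the bound [B] is available for [r < a] and only the
   bound 0 beyond. *)
pose a := t0 - s0.
have a0 : 0 <= a by rewrite subr_ge0.
have at0 : a <= t0 by rewrite /a; lra.
have inc (b x y : R) : 0 <= x -> x <= y -> y <= t0 ->
    (forall r j k, x < r < y -> b <= F (on_cone x0 t0 u r (tht j) (phi k))) ->
    P y - P x <= - (b * s) / 2 * (y ^+ 2 - x ^+ 2) + 2 * e * N.+1%:R ^+ 2 * (y - x).
  move=> x_ge0 xy yt bF.
  pose c := - (b * s) / 2; pose d := 2 * e * N.+1%:R ^+ 2.
  suff : P y - P x <= (c * y ^+ 2 + d * y) - (c * x ^+ 2 + d * x).
    by move/le_trans; apply; rewrite le_eqVlt; apply/orP; left; apply/eqP; rewrite /c /d; ring.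
  apply: (@increment_le R P (fun r => c * r ^+ 2 + d * r) dP (fun r => 2 * c * r + d)) => //.
  - exact: continuous_quadratic.
  - by move=> r /andP[_ ry]; apply: P_derive; exact: lt_le_trans yt.
  - by move=> r _; exact: is_derive_quadratic.
  move=> r /andP[xr ry]; rewrite [2 * c]mulrC divfK//; apply: dP_le.
    by rewrite (le_lt_trans x_ge0 xr) (lt_le_trans ry yt).
  by move=> j k; apply: bF; rewrite xr.
have cone_mem r j k : 0 <= r -> enorm (x0 + r *: radial (tht j) (phi k) - x0) <= t0 - (t0 - r).
  by move=> r0; rewrite subKr; exact: enorm_ray_le.
have inc1 : P a - P 0 <= - (B * s) / 2 * a ^+ 2 + 2 * e * N.+1%:R ^+ 2 * a.
  have := inc B 0 a (lexx 0) a0 at0; rewrite expr0n/= !subr0; apply => r j k /andP[r0 ra].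
  apply: F_geB; last by apply: cone_mem; exact: ltW.
  by move: ra; rewrite /a; lra.
have inc2 : P t0 - P a <= 2 * e * N.+1%:R ^+ 2 * (t0 - a).
  have := inc 0 a t0 a0 at0 (lexx t0); rewrite !mul0r oppr0 !mul0r add0r; apply => r j k /andP[ar rt].
  have r0 := le_lt_trans a0 ar.
  by apply: F_ge0; [lra|apply: cone_mem; exact: ltW].
have s_ge : N.+1%:R ^+ 2 / pi <= s by rewrite expr2 -mulrA ler_wpM2l.
have s_gt0 : 0 < s by apply: lt_le_trans s_ge; rewrite divr_gt0// exprn_gt0.
rewrite -(ler_pM2l s_gt0).
have : N.+1%:R ^+ 2 * (2 * t0 * e) <= s * e0.
  have -> : e0 = e * (2 * pi * t0) by rewrite divfK// gt_eqF.
  move: s_ge; rewrite ler_pdivrMr// => s_ge.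
  rewrite (_ : s * _ = (s * pi) * (2 * t0 * e)); last by ring.
  by apply: ler_wpM2r => //; apply: mulr_ge0; [apply: mulr_ge0; [|exact: ltW]|exact: ltW].
move: inc1 inc2 Pt0; rewrite P0 -/a.
set X := N.+1%:R ^+ 2; lra.
Qed.

End ConeLowerBound.

(** * Positivity and doubling *)

Section BlowUp.
Context {R : realType} {n : nat}.
Variables (u : 'rV[R]_n -> R -> R) (D1 : option 'I_n -> 'rV[R]_n -> R -> R)
  (D2 : option 'I_n -> option 'I_n -> 'rV[R]_n -> R -> R) (F : R -> R)
  (p A kappa R0 C0 : R).
Hypotheses (hn : n = 2%N \/ n = 3%N)
  (cu : continuous (fun q : 'rV[R]_n * R => u q.1 q.2))
  (pu : has_partials u D1) (pD1 : forall k, has_partials (D1 k) (D2 k))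
  (wave : forall x t, 0 < t ->
     D2 None None x t - \sum_i D2 (Some i) (Some i) x t = F (u x t))
  (p_gt1 : 1 < p) (A_gt0 : 0 < A) (F_ge : forall s, 0 <= s -> A * s `^ p <= F s)
  (kappa_gt0 : 0 < kappa) (C0_gt0 : 0 < C0)
  (data : forall x, R0 <= enorm x ->
     0 < u x 0 /\
     C0 / (1 + enorm x) `^ (1 + kappa)
       <= u x 0 / (1 + enorm x) - enorm (\row_i D1 (Some i) x 0) + D1 None x 0).

(** The hypothesis on the data is multiplied by [t]. Since [u x 0 > 0] and [t <= 1 + enorm x], the
    term [t * (u x 0 / (1 + enorm x))] is at most [u x 0]. *)
Lemma data_lower_bound (x : 'rV[R]_n) (t M : R) :
  R0 <= enorm x -> 0 <= t <= 1 + enorm x -> 1 + enorm x <= M ->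
  t * (C0 / M `^ (1 + kappa))
    <= u x 0 - t * enorm (\row_i D1 (Some i) x 0) + t * D1 None x 0.
Proof.
move=> xR /andP[t_ge0 t_le] xM; have [u0 H] := data x xR.
have N0 : 0 < 1 + enorm x by rewrite (lt_le_trans ltr01)// lerDl enorm_ge0.
have H1 : C0 / M `^ (1 + kappa) <= C0 / (1 + enorm x) `^ (1 + kappa).
  rewrite ler_pM2l// lef_pV2 ?posrE ?powR_gt0//; last exact: lt_le_trans xM.
  rewrite ge0_ler_powR ?nnegrE ?(ltW N0)//; first by rewrite addr_ge0// ltW.
  exact: le_trans (ltW N0) xM.
have := ler_wpM2l t_ge0 (le_trans H1 H).
have : t * (u x 0 / (1 + enorm x)) <= u x 0.
  by rewrite mulrCA ler_piMr ?(ltW u0)// ler_pdivrMr// mul1r.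
set X := C0 / _; set Y := u x 0 / _; lra.
Qed.

Variables (x0 : 'rV[R]_n) (T M : R).
Hypotheses (T_gt0 : 0 < T)
  (base : forall y, enorm (y - x0) <= T ->
     [/\ R0 <= enorm y, T <= 1 + enorm y & 1 + enorm y <= M]).

(** The triangle inequality. It allows [cone_lower_bound] to be applied at every point of the cone
    of [(x0, T)] with information from that cone alone. *)
Let subcone (y z : 'rV[R]_n) (s s' : R) :
  enorm (y - x0) <= T - s -> enorm (z - y) <= s - s' -> enorm (z - x0) <= T - s'.
Proof.
move=> H1 H2; rewrite (_ : z - x0 = (z - y) + (y - x0)); last by rewrite addrA subrK.
by apply: le_trans (enormD _ _) _; lra.
Qed.

Let eta := C0 / M `^ (1 + kappa).

Let M_gt0 : 0 < M.
Proof.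
have [|_ _ H] := base x0; first by rewrite subrr -(scale0r x0) enormZ normr0 mul0r ltW.
by apply: lt_le_trans H; rewrite (lt_le_trans ltr01)// lerDl enorm_ge0.
Qed.

Let eta_gt0 : 0 < eta. Proof. by rewrite divr_gt0// powR_gt0. Qed.

Let data_cone y s z : 0 <= s <= T -> enorm (y - x0) <= T - s -> enorm (z - y) <= s ->
  s * eta <= u z 0 - s * enorm (\row_i D1 (Some i) z 0) + s * D1 None z 0.
Proof.
move=> /andP[s0 sT] yx zy.
have [zR zT zM] : [/\ R0 <= enorm z, T <= 1 + enorm z & 1 + enorm z <= M].
  by apply: base; rewrite -[leRHS]subr0; apply: (subcone y z s) => //; rewrite subr0.
by apply: data_lower_bound => //; rewrite s0 (le_trans sT).
Qed.

(** A closed subset of a product of segments. Compactness provides an earliest time at which [u]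
    fails to be positive. *)
Lemma compact_cone : compact [set q : 'rV[R]_n * R |
  [/\ 0 <= q.2 <= T, enorm (q.1 - x0) <= T - q.2 & u q.1 q.2 <= 0]].
Proof.
pose side (i : 'I_n) : set R := `[x0 0 i - T, x0 0 i + T]%classic.
pose box : set ('rV[R]_n * R) := [set y : 'rV[R]_n | forall i, side i (y 0 i)] `*` `[0, T]%classic.
have cbox : compact box.
  apply: compact_setX; last exact: segment_compact.
  by apply: (rV_compact (A := side)) => i; exact: segment_compact.
pose Z : set ('rV[R]_n * R) :=
  [set q | enorm (q.1 - x0) + q.2 <= T] `&` [set q | u q.1 q.2 <= 0].
have -> : [set q : 'rV[R]_n * R |
  [/\ 0 <= q.2 <= T, enorm (q.1 - x0) <= T - q.2 & u q.1 q.2 <= 0]] = box `&` Z.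
  apply/seteqP; split => -[y s]/=.
    move=> [/andP[s0 sT] yT us]; split; last by split => //=; rewrite -lerBrDr.
    split => /=; last by rewrite in_itv/= s0.
    move=> i; rewrite /side /= in_itv/= -ler_distl.
    have : `|(y - x0) 0 i| <= enorm (y - x0).
      rewrite -sqrtr_sqr ler_wsqrtr// (bigD1 i)//= lerDl sumr_ge0// => j _.
      exact: sqr_ge0.
    by rewrite !mxE => /le_trans; apply; rewrite (le_trans yT)// gerBl.
  by move=> [[_ /=]]; rewrite in_itv/= => sT [/= yT us]; split => //; rewrite lerBrDr.
apply: compact_closedI => //; apply: closedI.
- have cZ : continuous (fun q : 'rV[R]_n * R => enorm (q.1 - x0) + q.2).
    apply: continuousD_fun; last by move=> q; exact: cvg_snd.
    move=> q.
    apply: (@continuous_comp _ _ _ (fun q : 'rV[R]_n * R => q.1 - x0) (@enorm R n)).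
      by apply: continuousB; [exact: cvg_fst|exact: cvg_cst].
    exact: continuous_enorm.
  apply: (@closed_comp _ _ (fun q : 'rV[R]_n * R => enorm (q.1 - x0) + q.2) [set a | a <= T]).
    by move=> q _; exact: cZ.
  exact: closed_le.
- apply: (@closed_comp _ _ (fun q : 'rV[R]_n * R => u q.1 q.2) [set a | a <= 0]).
    by move=> q _; exact: cu.
  exact: closed_le.
Qed.

(* At the first zero of u in the cone, F(u) is still nonnegative in the past, so
   the data force u > 0 there. *)
Lemma cone_positive y s : 0 <= s <= T -> enorm (y - x0) <= T - s -> 0 < u y s.
Proof.
move=> sT ys; rewrite ltNge; apply/negP => us.
have Zne : [set q : 'rV[R]_n * R |
  [/\ 0 <= q.2 <= T, enorm (q.1 - x0) <= T - q.2 & u q.1 q.2 <= 0]] !=set0.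
  by exists (y, s).
have [|[y1 s1]] := compact_EVT_min (f := snd) Zne compact_cone.
  by apply: continuous_subspaceT => q; exact: cvg_snd.
rewrite inE => -[/= /andP[s1_ge0 s1T] ys1 us1] s1_min.
(* At time 0 the data are positive on the base of the cone. *)
have s1_gt0 : 0 < s1.
  rewrite lt_neqAle s1_ge0 andbT; apply/eqP => s10; move: us1 ys1; rewrite -s10 subr0 => us1 ys1.
  have [R0y _ _] := base y1 ys1.
  by have [+ _] := data y1 R0y; rewrite ltNge us1.
(* Taking [s1] also as the starting time of the bound [B] leaves no time where [B] must be checked,
   so only the data term remains. *)
have : s1 * eta + 0 * (s1 - s1) ^+ 2 / 2 <= u y1 s1.
  apply: (cone_lower_bound u D1 D2 F hn cu pu pD1 wave) => //.
  - by rewrite s1_ge0 lexx.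
  - move=> z s' /andP[s'0 s's] zy.
    have uz : 0 < u z s'.
      rewrite ltNge; apply/negP => uz.
      suff : s1 <= s' by rewrite leNgt s's.
      apply: (s1_min (z, s')); rewrite inE; split => //=.
        by rewrite ltW//= (le_trans (ltW s's)).
      exact: (subcone y1 z s1).
    by apply: le_trans (F_ge _ (ltW uz)); rewrite mulr_ge0 ?powR_ge0// ltW.
  - by move=> z s' /andP[s1s' s's1]; move: (lt_trans s1s' s's1); rewrite ltxx.
  - by move=> z; apply: data_cone => //; rewrite s1_ge0.
rewrite !mul0r addr0 leNgt => /negP; apply.
by rewrite (le_lt_trans us1)// mulr_gt0.
Qed.

Lemma cone_step (y : 'rV[R]_n) (s s0 b : R) :
  0 < s <= T -> 0 <= s0 <= s -> enorm (y - x0) <= T - s -> 0 <= b ->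
  (forall z s', 0 <= s' <= T -> s0 <= s' -> enorm (z - x0) <= T - s' -> b <= u z s') ->
  s * eta + A * b `^ p * (s - s0) ^+ 2 / 2 <= u y s.
Proof.
move=> /andP[s_gt0 sT] s0s ys b0 ub.
apply: (cone_lower_bound u D1 D2 F hn cu pu pD1 wave) => //.
- move=> z s' /andP[s'0 s's] zy.
  have uz : 0 < u z s'.
    apply: cone_positive; last exact: (subcone y z s).
    by rewrite ltW//= (le_trans (ltW s's)).
  by apply: le_trans (F_ge _ (ltW uz)); rewrite mulr_ge0 ?powR_ge0// ltW.
- move=> z s' /andP[s0s' s's] zy.
  have s'0 : 0 <= s' by case/andP: s0s => s00 _; rewrite (le_trans s00)// ltW.
  have bu : b <= u z s'.
    apply: ub; [|exact: ltW|exact: (subcone y z s)].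
    by rewrite s'0 (le_trans (ltW s's)).
  apply: le_trans (F_ge _ (le_trans b0 bu)).
  rewrite ler_wpM2l ?(ltW A_gt0)// ge0_ler_powR ?nnegrE ?(le_trans b0 bu)//.
  by rewrite ltW// (lt_trans ltr01).
- by move=> z; apply: data_cone => //; rewrite (ltW s_gt0).
Qed.

(** Writing [p = 1 + (p - 1)] isolates the current level [2 ^+ j * e] and a factor growing
    geometrically in [j], to be compensated by the shrinking waiting times. *)
Lemma powR_exp2 (e : R) (j : nat) : 0 < e ->
  (2 ^+ j * e) `^ p = 2 ^+ j * e * ((2 `^ (p - 1)) ^+ j * e `^ (p - 1)).
Proof.
move=> e0; have p2e : 0 < 2 ^+ j * e by rewrite mulr_gt0// exprn_gt0.
have -> : (2 ^+ j * e) `^ p = (2 ^+ j * e) `^ (1 + (p - 1)) by congr (_ `^ _); ring.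
rewrite (powRD (x := 2 ^+ j * e)); last by rewrite (gt_eqF p2e) implybT.
rewrite powRr1 ?(ltW p2e)//; congr (_ * _).
rewrite powRM ?ltW ?exprn_gt0//; congr (_ * _).
elim: j {p2e} => [|j IH]; first by rewrite !expr0 powR1.
by rewrite !exprS powRM ?exprn_ge0// IH.
Qed.

(* The time needed to double u shrinks geometrically, by the factor q. *)
Lemma cone_doubling (q : R) : 0 < q < 1 -> q ^+ 2 * 2 `^ (p - 1) = 1 ->
  16 <= A * (T / 2 * eta) `^ (p - 1) * T ^+ 2 * (1 - q) ^+ 2 ->
  forall j y s, s <= T -> T - T / 2 * q ^+ j <= s -> enorm (y - x0) <= T - s ->
    2 ^+ j * (T / 2 * eta) <= u y s.
Proof.
move=> /andP[q0 q1] q2 big; set e := T / 2 * eta.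
have e_gt0 : 0 < e by rewrite mulr_gt0// divr_gt0.
have qj j : 0 < q ^+ j <= 1 by rewrite exprn_gt0//= exprn_ile1// ltW.
have sj j : T / 2 <= T - T / 2 * q ^+ j <= T.
  have /andP[h1 h2] := qj j; have T2 : 0 < T / 2 by rewrite divr_gt0.
  have := mulr_gt0 T2 h1; have := ler_wpM2l (ltW T2) h2; rewrite mulr1.
  by move=> h3 h4; apply/andP; split; lra.
elim=> [|j IH] y s sT + ys.
  rewrite expr0 mulr1 expr0 mul1r => Ts.
  have s0 : 0 < s by move: Ts T_gt0; lra.
  (* At level 0 the source is ignored: [s >= T / 2], so the data term [s * eta] is already
     enough. *)
  have := cone_step y s s 0; rewrite subrr expr0n/= mulr0 mul0r addr0 => H.
  apply: le_trans (H _ _ ys _ _) => //; last first.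
  - by move=> z s' s'T _ zs'; apply/ltW/cone_positive.
  - by rewrite ltW//=.
  - by rewrite s0.
  by rewrite /e ler_wpM2r ?(ltW eta_gt0)//; lra.
move=> Ts; have /andP[sj1 sj2] := sj j; have /andP[sj3 sj4] := sj j.+1.
have s0 : 0 < s by move: Ts sj3 T_gt0; set X := T - _; lra.
(* The waiting time between levels [j] and [j.+1] is [T / 2 * q ^+ j * (1 - q)]. *)
have jj : T - T / 2 * q ^+ j + T / 2 * q ^+ j * (1 - q) = T - T / 2 * q ^+ j.+1.
  by rewrite exprSr; ring.
have w0 : 0 <= T / 2 * q ^+ j * (1 - q).
  by rewrite !mulr_ge0 ?subr_ge0 ?(ltW q1) ?exprn_ge0 ?(ltW q0) ?divr_ge0 ?(ltW T_gt0).
have ge : T / 2 * q ^+ j * (1 - q) <= s - (T - T / 2 * q ^+ j) by lra.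
have H : s * eta + A * (2 ^+ j * e) `^ p * (s - (T - T / 2 * q ^+ j)) ^+ 2 / 2 <= u y s.
  apply: cone_step => //.
  - by rewrite s0.
  - by apply/andP; split; lra.
  - by rewrite mulr_ge0 ?exprn_ge0// ltW.
  - by move=> z s' /andP[_ s'T] Hs' zs'; exact: IH.
apply: le_trans H.
have H1 : A * (2 ^+ j * e) `^ p * (T / 2 * q ^+ j * (1 - q)) ^+ 2 / 2
    <= A * (2 ^+ j * e) `^ p * (s - (T - T / 2 * q ^+ j)) ^+ 2 / 2.
  rewrite ler_pM2r ?invr_gt0// ler_wpM2l ?mulr_ge0 ?powR_ge0 ?(ltW A_gt0)//.
  by rewrite ler_sqr ?nnegrE// (le_trans w0).
have H0 : 0 <= s * eta by rewrite mulr_ge0// ltW.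
have E1 : (q ^+ 2) ^+ j * (2 `^ (p - 1)) ^+ j = 1 by rewrite -exprMn q2 expr1n.
(* The choice of [q] removes [j] from the gain. The 8 collects the square of [T / 2] and Kirchhoff's
   factor one half; the 16 in the hypothesis thus yields the factor 2. *)
have H2 : A * (2 ^+ j * e) `^ p * (T / 2 * q ^+ j * (1 - q)) ^+ 2 / 2 =
    (A * e `^ (p - 1) * T ^+ 2 * (1 - q) ^+ 2) * (2 ^+ j * e) / 8.
  rewrite powR_exp2// -[RHS]mulr1 -[X in _ = _ * X]E1 exprAC.
  by field.
have je0 : 0 < 2 ^+ j * e by rewrite mulr_gt0// exprn_gt0.
have H3 := ler_wpM2r (ltW je0) big.
have E2 : 2 ^+ j.+1 * e = 2 * (2 ^+ j * e) by rewrite exprS mulrA.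
rewrite E2; move: H1; rewrite H2; move: H3.
set X1 := _ * (2 ^+ j * e); set X2 := _ / 2; set X3 := 2 ^+ j * e; lra.
Qed.

End BlowUp.

(** * Choice of the time scale, and conclusion *)

Lemma exists_large_time {R : realType} (p A kappa R0 C0 w : R) :
  1 < p -> 0 < A -> kappa < 2 / (p - 1) -> 0 < C0 -> 0 < w ->
  exists T, [/\ 1 <= T, R0 <= T &
    16 <= A * (T / 2 * (C0 / (6 * T) `^ (1 + kappa))) `^ (p - 1) * T ^+ 2 * w].
Proof.
move=> p1 A0 kp C00 w0; have p10 : 0 < p - 1 by rewrite subr_gt0.
pose c := C0 / 2 / 6 `^ (1 + kappa).
have c0 : 0 < c by rewrite !divr_gt0// powR_gt0.
pose gamma := 2 - kappa * (p - 1).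
have g0 : 0 < gamma by rewrite subr_gt0 -ltr_pdivlMr.
pose k := A * c `^ (p - 1) * w.
have k0 : 0 < k by rewrite !mulr_gt0// powR_gt0.
pose Y := (16 / k) `^ gamma^-1.
have Y0 : 0 <= Y by exact: powR_ge0.
pose T := Num.max 1 R0 + Y.
have T1 : 1 <= T by rewrite (@le_trans _ _ (Num.max 1 R0)) ?lerDl// le_max lexx.
have T0 : 0 < T by exact: lt_le_trans T1.
have TY : Y <= T by rewrite lerDr (@le_trans _ _ 1)// le_max lexx.
exists T; split => //; first by rewrite (@le_trans _ _ (Num.max 1 R0)) ?lerDl// le_max lexx orbT.
have Tn (r s : R) : (r + s == 0) ==> (T != 0) by apply/implyP => _; rewrite gt_eqF.
have E1 : T / 2 * (C0 / (6 * T) `^ (1 + kappa)) = c * T `^ (- kappa).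
  rewrite powRM ?(ltW T0)// [T `^ (1 + _)]powRD ?Tn// powRr1 ?(ltW T0)// powRN /c.
  have a0 : 6 `^ (1 + kappa) != 0 :> R by rewrite gt_eqF// powR_gt0.
  have b0 : T `^ kappa != 0 by rewrite gt_eqF// powR_gt0.
  have d0 : T != 0 by rewrite gt_eqF.
  by field; rewrite a0 b0 d0.
have E2 : (c * T `^ (- kappa)) `^ (p - 1) * T ^+ 2 = c `^ (p - 1) * T `^ gamma.
  rewrite powRM ?(ltW c0) ?powR_ge0// -powRrM -powR_mulrn ?(ltW T0)// -mulrA -powRD ?Tn//.
  by congr (_ * _ `^ _); rewrite /gamma; ring.
rewrite E1 -[A * _ * _]mulrA E2.
rewrite (_ : _ * w = k * T `^ gamma); last by rewrite /k; ring.
rewrite mulrC -ler_pdivrMr//.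
have -> : 16 / k = Y `^ gamma by rewrite -powRrM mulVf ?gt_eqF// powRr1// divr_ge0// ltW.
by rewrite ge0_ler_powR ?nnegrE ?(ltW g0) ?(ltW T0).
Qed.

(** At time 0 the spatial difference quotients of [u] are those of [f]; this carries the hypothesis
    on [gradnorm f] over to the derivatives of the solution. *)
Lemma pd_initial {R : realType} {n : nat} (f : 'rV[R]_n -> R) (u w : 'rV[R]_n -> R -> R)
    (i : 'I_n) (x : 'rV[R]_n) :
  (forall x, u x 0 = f x) -> pd (Some i) u w -> 'D_(evec R i) f x = w x 0.
Proof.
move=> uf /(_ x 0 (lexx 0)) H; apply: cvg_lim => //.
rewrite (_ : (fun h : R => _) = (fun h : R => h^-1 * (u (x + h *: evec R i) 0 - u x 0)))//.
by apply/funext => h; rewrite !uf /= (addrC x).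
Qed.

Theorem theorem2p1 (R : realType) (n : nat) (p A kappa R0 C0 : R)
  (F : R -> R) (f g : 'rV[R]_n -> R) :
  (n = 2%N \/ n = 3%N) ->
  1 < p ->
  (forall s, derivable F s 1) -> continuous (derive1 F) ->
  0 < A -> (forall s : R, 0 <= s -> A * s `^ p <= F s) ->
  0 < kappa -> kappa < 2 / (p - 1) ->
  Ck 3 f -> Ck 2 g ->
  0 < R0 -> 0 < C0 ->
  (forall x : 'rV[R]_n, R0 <= enorm x ->
     0 < f x /\
     C0 / (1 + enorm x) `^ (1 + kappa)
       <= f x / (1 + enorm x) - gradnorm f x + g x) ->
  ~ (exists u : 'rV[R]_n -> R -> R, global_classical_solution F f g u).
Proof.
move=> hn p1 _ _ A0 F_ge kappa0 kp _ _ R00 C00 data [u [D1 [D2 [cu [H1 [H2 [wave [uf ug]]]]]]]].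
have p10 : 0 < p - 1 by rewrite subr_gt0.
pose v := clamp u; pose d1 k := clamp (D1 k); pose d2 k l := clamp (D2 k l).
have cv : continuous (fun q : 'rV[R]_n * R => v q.1 q.2) by exact: continuous_clamp.
have pv : has_partials v d1 by exact: has_partials_clamp.
have pd1 k : has_partials (d1 k) (d2 k) by apply: has_partials_clamp; exact: H2.
have wv x t : 0 < t -> d2 None None x t - \sum_i d2 (Some i) (Some i) x t = F (v x t).
  move=> t0; rewrite /v /d2 !clampE ?(ltW t0)//.
  by under eq_bigr do rewrite clampE ?(ltW t0)//; exact/wave/ltW.
have dv x : R0 <= enorm x -> 0 < v x 0 /\ C0 / (1 + enorm x) `^ (1 + kappa)
    <= v x 0 / (1 + enorm x) - enorm (\row_i d1 (Some i) x 0) + d1 None x 0.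
  move=> /data; rewrite /v /d1 !clampE// uf ug.
  suff -> : enorm (\row_i clamp (D1 (Some i)) x 0) = gradnorm f x by [].
  congr Num.sqrt; apply: eq_bigr => i _.
  by rewrite mxE clampE// (pd_initial _ _ _ _ _ uf (H1 (Some i)).1).
(* Doubling [u] multiplies [A * u]^ (p - 1)[by]2 [^ (p - 1)], so the waiting time is divided by the
   square root of that factor. *)
pose q : R := Num.sqrt (2 `^ (p - 1))^-1.
have P1 : 1 < 2 `^ (p - 1) :> R.
  have := @gt0_ltr_powR R (p - 1) p10 1 2; rewrite powR1 !nnegrE.
  by apply => //; rewrite ltr1n.
have q2 : q ^+ 2 * 2 `^ (p - 1) = 1.
  by rewrite sqr_sqrtr ?invr_ge0 ?powR_ge0// mulVf// gt_eqF// powR_gt0.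
have q0 : 0 < q by rewrite sqrtr_gt0 invr_gt0 powR_gt0.
have q1 : q < 1 by rewrite -[ltRHS]sqrtr1 ltr_sqrt// invf_lt1// powR_gt0.
have w0 : 0 < (1 - q) ^+ 2 by rewrite exprn_gt0// subr_gt0.
have [T [T1 TR big]] := exists_large_time p A kappa R0 C0 _ p1 A0 kp C00 w0.
have T0 : 0 < T by exact: lt_le_trans T1.
have n0 : (0 < n)%N by case: hn => ->.
(* On the ball of radius [T] around [x0] the norm lies between [3 * T] and [5 * T]; with [1 <= T]
   and [R0 <= T] this gives [base] with [M = 6 * T]. *)
pose x0 : 'rV[R]_n := (4 * T) *: evec R (Ordinal n0).
have x0E : enorm x0 = 4 * T.
  rewrite enormZ ger0_norm ?mulr_ge0 ?(ltW T0)// -[RHS]mulr1; congr (_ * _).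
  rewrite -sqrtr1; congr Num.sqrt; rewrite (bigD1 (Ordinal n0))//= big1 => [|i ne].
    by rewrite mxE !eqxx expr1n addr0.
  by rewrite mxE (negbTE ne) andbF expr0n.
have base y : enorm (y - x0) <= T -> [/\ R0 <= enorm y, T <= 1 + enorm y & 1 + enorm y <= 6 * T].
  move=> yx.
  have := enormD (y - x0) x0; rewrite subrK x0E.
  have := enormD (x0 - y) y; rewrite subrK x0E -opprB enormN.
  by move=> h1 h2; split; lra.
pose e := T / 2 * (C0 / (6 * T) `^ (1 + kappa)).
have e0 : 0 < e by rewrite !mulr_gt0 ?invr_gt0 ?powR_gt0 ?mulr_gt0.
(* The apex time [T] lies beyond the starting time of every level, so all the bounds hold at the
   single point [(x0, T)]. *)
have grow j : 2 ^+ j * e <= v x0 T.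
  apply: (cone_doubling v d1 d2 F p A kappa R0 C0 hn cv pv pd1 wv p1 A0 F_ge kappa0 C00 dv
    x0 T (6 * T) T0 base q) => //.
  - by rewrite q0.
  - by rewrite gerBl mulr_ge0 ?exprn_ge0 ?divr_ge0 ?(ltW T0) ?(ltW q0).
  - by rewrite !subrr -(scale0r x0) enormZ normr0 mul0r.
have v0 : 0 <= v x0 T / e by rewrite divr_ge0 ?(ltW e0)// (le_trans _ (grow 0%N))// mulr_ge0 ?(ltW e0).
have := archi_boundP v0; set j := Num.bound _ => vj.
have := grow j; rewrite -ler_pdivlMr// leNgt => /negP; apply.
by apply: lt_le_trans vj _; rewrite -natrX ler_nat ltnW// ltn_expl.
Qed.
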